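(* For $g \geq 1$ and $k \geq 0$, we have $$\mathrm{H}_k\left(\mathbb{Z}^{2g}; [\pi_1(\Sigma_g),\pi_1(\Sigma_g)]^{\mathrm{ab}}\right) \cong \begin{cases} (\wedge^2\, \mathbb{Z}^{2g})/\mathbb{Z} & \text{if } k = 0,\\ \wedge^{k+2}\, \mathbb{Z}^{2g} & \text{if } k \geq 1.\end{cases}$$ In particular, $[\pi_1(\Sigma_g),\pi_1(\Sigma_g)]^{\mathrm{ab}}$ is not a free $\mathbb{Z}[\mathbb{Z}^{2g}]$-module for $g \geq 2$.
   Context: $\Sigma_g$ is a closed oriented surface of genus $g$, with fundamental group $\pi_1(\Sigma_g) = \left\langle x_1,\ldots,x_{2g} \mid [x_1,x_2]\cdots[x_{2g-1},x_{2g}] = 1\right\rangle$, where $[x,y] = x^{-1}y^{-1}xy$ for elements $x,y$ of a group. The group $[\pi_1(\Sigma_g),\pi_1(\Sigma_g)]$ is the commutator subgroup of $\pi_1(\Sigma_g)$, and for a group $G$, $G^{\mathrm{ab}}$ denotes its abelianization. The conjugation action of $\pi_1(\Sigma_g)$ on $[\pi_1(\Sigma_g),\pi_1(\Sigma_g)]$ induces an action on $[\pi_1(\Sigma_g),\pi_1(\Sigma_g)]^{\mathrm{ab}}$ that factors through $\pi_1(\Sigma_g)/[\pi_1(\Sigma_g),\pi_1(\Sigma_g)] \cong \mathrm{H}_1(\Sigma_g) \cong \mathbb{Z}^{2g}$, making $[\pi_1(\Sigma_g),\pi_1(\Sigma_g)]^{\mathrm{ab}}$ into a module over the group ring $\mathbb{Z}[\mathbb{Z}^{2g}]$.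 $\mathrm{H}_k(G;M)$ denotes the $k$-th group homology of $G$ with coefficients in the $\mathbb{Z}[G]$-module $M$, and $\wedge^{m}\,\mathbb{Z}^{2g}$ is the $m$-th exterior power of $\mathbb{Z}^{2g}$ over $\mathbb{Z}$. *)

(* Defs.v *)
(* Homology of Z^2g with coefficients in [pi_1(S_g), pi_1(S_g)]^ab, in
   MathComp, with the classical axioms of mathcomp.classical.boolp to get
   quotients by undecidable relations. *)
From HB Require Import structures.
From mathcomp Require Import all_boot all_algebra.
From mathcomp Require Import finmap.
From mathcomp Require Import boolp.
From mathcomp Require Import monalg.

Set Implicit Arguments.
Unset Strict Implicit.
Unset Printing Implicit Defensive.

Import GRing.Theory.

Local Open Scope quotient_scope.
Local Open Scope ring_scope.

Definition zmod_iso (U V : zmodType) : Prop :=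
  exists f : {additive U -> V}, bijective f.

Inductive zspan (V : zmodType) (P : V -> Prop) : V -> Prop :=
| zspan0 : zspan P 0
| zspan_gen x of P x : zspan P x
| zspanB x y of zspan P x & zspan P y : zspan P (x - y).

Definition zspan_pred (V : zmodType) (P : V -> Prop) : {pred V} :=
  fun x => `[< zspan P x >].

Section ZspanClosed.
Variables (V : zmodType) (P : V -> Prop).

Fact zspan_closed : zmod_closed (zspan_pred P).
Proof.
split=> [|x y /asboolP Px /asboolP Py]; apply/asboolP; first exact: zspan0.
exact: zspanB.
Qed.

HB.instance Definition _ :=
  GRing.isZmodClosed.Build V (zspan_pred P) zspan_closed.
End ZspanClosed.

Definition zquot (V : zmodType) (P : V -> Prop) : zmodType :=
  Quotient.quot (zspan_pred P).

(* A free module need not have finite rank: the coordinates in the basis are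
   finitely supported functions on an arbitrary index type. *)
Definition free_module (R : nzRingType) (M : lmodType R) : Prop :=
  exists (I : choiceType) (b : I -> M), forall m : M,
    exists! c : {malg R[I]}, m = \sum_(i <- msupp c) c@_i *: b i.

Section Exterior.
Variables (m : nat) (V : zmodType).
Implicit Types (t : {ffun 'I_m -> V}) (i j : 'I_m) (x y : V).

Definition upd t i x : {ffun 'I_m -> V} :=
  [ffun j => if j == i then x else t j].

(* Over Z, multilinearity amounts to additivity in each argument. *)
Inductive ext_rel : {malg int[{ffun 'I_m -> V}]} -> Prop :=
| ext_rel_add t i x y :
    ext_rel (<< upd t i (x + y) >> - << upd t i x >> - << upd t i y >>)
| ext_rel_alt t i j of i != j & t i = t j : ext_rel << t >>.

Definition extpow : zmodType := zquot ext_rel.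

Definition wedge t : extpow := \pi_(Quotient.quot (zspan_pred ext_rel)) << t >>.
End Exterior.

Definition gring (G : groupType) : Type := {malg int[G]}.

HB.instance Definition _ (G : groupType) := GRing.Zmodule.on (gring G).

Definition gelt (G : groupType) (x : G) : gring G := << x >>.

Section GroupRing.
Variable G : groupType.
Implicit Types (a b c : gring G) (x y z : G).

Definition gr_one : gring G := << 1%g >>.

Definition gr_mul a b : gring G :=
  \sum_(x <- msupp a) \sum_(y <- msupp b) << a@_x * b@_y *g (x * y)%g >>.

Lemma gr_mulw (d1 d2 : {fset G}) a b :
    (msupp a `<=` d1)%fset -> (msupp b `<=` d2)%fset ->
  gr_mul a b = \sum_(x <- d1) \sum_(y <- d2) << a@_x * b@_y *g (x * y)%g >>.
Proof.
move=> le1 le2; rewrite /gr_mul (big_fset_incl _ le1) /=.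
  apply/eq_bigr=> x _; apply/big_fset_incl => // y _ /mcoeff_outdom ->.
  by rewrite mulr0 monalgU0.
move=> x _ /mcoeff_outdom ax.
by rewrite big1 => // y _; rewrite ax mul0r monalgU0.
Qed.

Lemma gr_mulDl : left_distributive gr_mul +%R.
Proof.
move=> a b c; pose d := (msupp a `|` msupp b)%fset.
rewrite (gr_mulw (msuppD_le a b) (fsubset_refl _)).
rewrite (gr_mulw (fsubsetUl _ (msupp b)) (fsubset_refl (msupp c))).
rewrite (gr_mulw (fsubsetUr (msupp a) _) (fsubset_refl (msupp c))).
rewrite -big_split /=; apply/eq_bigr=> x _.
rewrite -big_split /=; apply/eq_bigr=> y _.
by rewrite mcoeffD mulrDl monalgUD.
Qed.

Lemma gr_mulDr : right_distributive gr_mul +%R.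
Proof.
move=> a b c.
rewrite (gr_mulw (fsubset_refl _) (msuppD_le b c)).
rewrite (gr_mulw (fsubset_refl (msupp a)) (fsubsetUl _ (msupp c))).
rewrite (gr_mulw (fsubset_refl (msupp a)) (fsubsetUr (msupp b) _)).
rewrite -big_split /=; apply/eq_bigr=> x _.
rewrite -big_split /=; apply/eq_bigr=> y _.
by rewrite mcoeffD mulrDr monalgUD.
Qed.

Lemma gr_mul0l c : gr_mul 0 c = 0.
Proof. by rewrite /gr_mul msupp0 big_seq_fset0. Qed.

Lemma gr_mul0r c : gr_mul c 0 = 0.
Proof. by rewrite /gr_mul big1 // => x _; rewrite msupp0 big_seq_fset0. Qed.

Lemma gr_mulUU (n m : int) x y :
  gr_mul << n *g x >> << m *g y >> = << n * m *g (x * y)%g >>.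
Proof. by rewrite (gr_mulw msuppU_le msuppU_le) !big_seq_fset1 !mcoeffUU. Qed.

Lemma gr_ind (P : gring G -> Prop) :
    P 0 -> (forall a b, P a -> P b -> P (a + b)) ->
  (forall n x, P << n *g x >>) -> forall a, P a.
Proof. by move=> P0 PD PU a; rewrite (monalgE a); apply: big_ind. Qed.

Lemma gr_mulA : associative gr_mul.
Proof.
move=> a b c; elim/gr_ind: a => [|a1 a2 IH1 IH2|n x]; first by rewrite !gr_mul0l.
  by rewrite !gr_mulDl IH1 IH2.
elim/gr_ind: b => [|b1 b2 IH1 IH2|m y].
- by rewrite gr_mul0r !gr_mul0l gr_mul0r.
- by rewrite gr_mulDr !gr_mulDl gr_mulDr IH1 IH2.
elim/gr_ind: c => [|c1 c2 IH1 IH2|p z]; first by rewrite !gr_mul0r.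
  by rewrite !gr_mulDr IH1 IH2.
by rewrite !gr_mulUU mulrA mulgA.
Qed.

Lemma gr_mul1l : left_id gr_one gr_mul.
Proof.
elim/gr_ind=> [|a b IHa IHb|n x]; rewrite ?gr_mul0r ?gr_mulDr ?IHa ?IHb //.
by rewrite gr_mulUU mul1r mul1g.
Qed.

Lemma gr_mul1r : right_id gr_one gr_mul.
Proof.
elim/gr_ind=> [|a b IHa IHb|n x]; rewrite ?gr_mul0l ?gr_mulDl ?IHa ?IHb //.
by rewrite gr_mulUU mulr1 mulg1.
Qed.

Lemma gr_one_neq0 : gr_one != 0.
Proof. by rewrite /gr_one monalgU_eq0 oner_eq0. Qed.

HB.instance Definition _ := GRing.Zmodule_isNzRing.Build (gring G)
  gr_mulA gr_mul1l gr_mul1r gr_mulDl gr_mulDr gr_one_neq0.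
End GroupRing.

Record gaction (G : groupType) (V : zmodType) := GAction {
  gact :> G -> V -> V;
  gact_add : forall x, {morph gact x : v w / v + w};
  gact_one : forall v, gact 1%g v = v;
  gact_mul : forall x y v, gact (x * y)%g v = gact x (gact y v) }.

(* An alias of V that carries the Z[G]-module structure given by to. *)
Definition gmod (G : groupType) (V : zmodType) (to : gaction G V) : Type := V.

HB.instance Definition _ (G : groupType) (V : zmodType) (to : gaction G V) :=
  GRing.Zmodule.on (gmod to).

Section GModule.
Variables (G : groupType) (V : zmodType) (to : gaction G V).
Implicit Types (a b : gring G) (v w : gmod to).

Definition gmod_scale a v : gmod to := \sum_(x <- msupp a) to x v *~ a@_x.

Lemma gmod_scalew (d : {fset G}) a v : (msupp a `<=` d)%fset ->
  gmod_scale a v = \sum_(x <- d) to x v *~ a@_x.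
Proof.
move=> le; rewrite /gmod_scale (big_fset_incl _ le) //= => x _ /mcoeff_outdom.
by move->; rewrite mulr0z.
Qed.

Lemma gact0 x : to x 0 = 0.
Proof. by apply: (addrI (to x 0)); rewrite -gact_add !addr0. Qed.

Lemma gactN x v : to x (- v) = - to x v.
Proof. by apply: (addrI (to x v)); rewrite -gact_add !subrr gact0. Qed.

Lemma gactMn x v n : to x (v *+ n) = to x v *+ n.
Proof. by elim: n => [|n IHn]; rewrite ?gact0 // !mulrS gact_add IHn. Qed.

Lemma gactMz x v n : to x (v *~ n) = to x v *~ n.
Proof. by case: n => n; rewrite ?NegzE ?mulrNz ?gactN gactMn. Qed.

Lemma gmod_scaleU n x v : gmod_scale << n *g x >> v = to x v *~ n.
Proof. by rewrite (gmod_scalew _ msuppU_le) big_seq_fset1 mcoeffUU. Qed.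

Lemma gmod_scaleDl v : {morph gmod_scale^~ v : a b / a + b}.
Proof.
move=> a b; rewrite (gmod_scalew _ (msuppD_le a b)).
rewrite (gmod_scalew v (fsubsetUl _ (msupp b))).
rewrite (gmod_scalew v (fsubsetUr (msupp a) _)) -big_split /=.
by apply/eq_bigr=> x _; rewrite mcoeffD mulrzDr.
Qed.

Lemma gmod_scaleDr : right_distributive gmod_scale +%R.
Proof.
move=> a v w; rewrite /gmod_scale -big_split /=.
by apply/eq_bigr=> x _; rewrite gact_add mulrzDl.
Qed.

Lemma gmod_scale0l v : gmod_scale 0 v = 0.
Proof. by rewrite /gmod_scale msupp0 big_seq_fset0. Qed.

Lemma gmod_scale0r a : gmod_scale a 0 = 0.
Proof. by rewrite /gmod_scale big1 // => x _; rewrite gact0 mul0rz. Qed.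

Lemma gmod_scaleA a b v :
  gmod_scale a (gmod_scale b v) = gmod_scale (a * b) v.
Proof.
elim/gr_ind: a => [|a1 a2 IH1 IH2|n x]; first by rewrite mul0r !gmod_scale0l.
  by rewrite mulrDl !gmod_scaleDl IH1 IH2.
elim/gr_ind: b => [|b1 b2 IH1 IH2|m y].
- by rewrite mulr0 gmod_scale0l gmod_scale0r.
- by rewrite mulrDr !gmod_scaleDl gmod_scaleDr IH1 IH2.
rewrite [_ * _]gr_mulUU !gmod_scaleU.
by rewrite gactMz gact_mul -mulrzA mulrC.
Qed.

Lemma gmod_scale1 : left_id 1 gmod_scale.
Proof. by move=> v; rewrite [1]/(gr_one G) gmod_scaleU gact_one mulr1z. Qed.

HB.instance Definition _ := GRing.Zmodule_isLmodule.Build (gring G) (gmod to)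
  gmod_scaleA gmod_scale1 gmod_scaleDr gmod_scaleDl.
End GModule.

Section GroupHomology.
Variables (G : groupType) (M : lmodType (gring G)).

(* Degree k of F (x)_G M, for F the inhomogeneous bar resolution of Z: the
   function supported on t with value v is m (x) [t_0 | ... | t_(k-1)]. *)
Definition chain (k : nat) : zmodType := {malg M[{ffun 'I_k -> G}]}.

Section Boundary.
Variable k : nat.
Implicit Types (t : {ffun 'I_k.+1 -> G}).

Definition face_first t : {ffun 'I_k -> G} := [ffun j => t (lift ord0 j)].

Definition face_last t : {ffun 'I_k -> G} := [ffun j => t (lift ord_max j)].

(* [t_0 | ... | t_i * t_(i+1) | ... | t_k] *)
Definition face_mid t (i : 'I_k) : {ffun 'I_k -> G} :=
  [ffun j : 'I_k => if (j < i)%N then t (lift ord_max j)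
                    else if j == i then (t (lift ord_max j) * t (lift ord0 j))%g
                    else t (lift ord0 j)].

(* The left module M is made into a right one by v.g = g^-1 v, so that
   v (x) t_0[t_1 | ... | t_k] = t_0^-1 v (x) [t_1 | ... | t_k]. *)
Definition bdry_gen t (v : M) : chain k :=
  << gelt ((t ord0)^-1)%g *: v *g face_first t >>
  + \sum_(i < k) << (-1) ^+ i.+1 *: v *g face_mid t i >>
  + << (-1) ^+ k.+1 *: v *g face_last t >>.

Definition bdry (c : chain k.+1) : chain k :=
  \sum_(t <- msupp c) bdry_gen t c@_t.

Lemma bdry_genB t : {morph bdry_gen t : v w / v - w}.
Proof.
move=> v w; rewrite /bdry_gen !scalerBr !monalgUB.
under eq_bigr do rewrite scalerBr monalgUB.
by rewrite sumrB [X in X + _ = _]addrACA -opprD addrACA -opprD.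
Qed.

Lemma bdry_gen0 t : bdry_gen t 0 = 0.
Proof. by rewrite -[X in bdry_gen t X](subrr 0) bdry_genB subrr. Qed.

Lemma bdryw (d : {fset {ffun 'I_k.+1 -> G}}) (c : chain k.+1) :
  (msupp c `<=` d)%fset -> bdry c = \sum_(t <- d) bdry_gen t c@_t.
Proof.
move=> le; rewrite /bdry (big_fset_incl _ le) //= => t _ /mcoeff_outdom ->.
exact: bdry_gen0.
Qed.

Fact bdry_is_additive : zmod_morphism bdry.
Proof.
move=> c c'; rewrite (bdryw (msuppB_le c c')).
rewrite (bdryw (fsubsetUl _ (msupp c'))) (bdryw (fsubsetUr (msupp c) _)).
rewrite -sumrB; apply/eq_bigr=> t _.
by rewrite mcoeffB bdry_genB.
Qed.

HB.instance Definition _ :=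
  GRing.isZmodMorphism.Build (chain k.+1) (chain k) bdry bdry_is_additive.
End Boundary.

Definition cycle (k : nat) : {pred chain k} :=
  match k with
  | 0 => predT
  | k'.+1 => fun c => bdry c == 0
  end.

Fact cycle_closed k : zmod_closed (@cycle k).
Proof.
case: k => [|k]; first by split.
split=> [|c c']; rewrite !unfold_in /=; first by rewrite raddf0.
by move=> /eqP c0 /eqP c'0; rewrite raddfB /= c0 c'0 subrr.
Qed.

Record cycles (k : nat) := Cycle { cycle_val :> chain k; _ : cycle cycle_val }.

HB.instance Definition _ k := [isSub for @cycle_val k].
HB.instance Definition _ k := [Choice of cycles k by <:].
HB.instance Definition _ k :=
  GRing.SubChoice_isSubZmodule.Build _ _ (cycles k) (@cycle_closed k).

Definition boundary (k : nat) : {pred cycles k} :=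
  fun z => `[< exists c, bdry c = val z >].

Fact boundary_closed k : zmod_closed (@boundary k).
Proof.
split=> [|z w /asboolP[c cz] /asboolP[d dw]]; apply/asboolP.
  by exists 0; rewrite !raddf0.
by exists (c - d); rewrite !raddfB /= cz dw.
Qed.

HB.instance Definition _ k :=
  GRing.isZmodClosed.Build (cycles k) (@boundary k) (@boundary_closed k).

Definition homology (k : nat) : zmodType := Quotient.quot (@boundary k).
End GroupHomology.

Section Derived.
Local Open Scope group_scope.
Variable G : groupType.
Implicit Types (x y z : G).

(* In monoid, [~ x, y] is x^-1 * (y^-1 * (x * y)). *)
Inductive comm_span : G -> Prop :=
| comm_span1 : comm_span 1
| comm_span_gen x y : comm_span [~ x, y]
| comm_spanF x y of comm_span x & comm_span y : comm_span (x / y).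

Definition derived_pred : {pred G} := fun x => `[< comm_span x >].

Fact derived_closed : group_closed derived_pred.
Proof.
split=> [|x y /asboolP Dx /asboolP Dy]; apply/asboolP; first exact: comm_span1.
exact: comm_spanF.
Qed.

Lemma derived1 : derived_pred 1.
Proof. exact: derived_closed.1. Qed.

Lemma derivedF x y : derived_pred x -> derived_pred y -> derived_pred (x / y).
Proof. exact: derived_closed.2. Qed.

Lemma derivedV x : derived_pred x -> derived_pred x^-1.
Proof. by move=> Dx; rewrite -[x^-1]mul1g derivedF ?derived1. Qed.

Lemma derivedM x y : derived_pred x -> derived_pred y -> derived_pred (x * y).
Proof. by move=> Dx Dy; rewrite -[y]invgK derivedF ?derivedV. Qed.

Lemma derivedR x y : derived_pred [~ x, y].
Proof. by apply/asboolP; apply: comm_span_gen. Qed.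

Lemma derivedJ x y : derived_pred x -> derived_pred (y * x * y^-1).
Proof.
move=> Dx; have -> : y * x * y^-1 = x * [~ x, y^-1].
  by rewrite /commg /conjg invgK !mulgA mulgV mul1g.
by rewrite derivedM ?derivedR.
Qed.

Record derived := Derived { derived_val :> G; _ : derived_pred derived_val }.

HB.instance Definition _ := [isSub for derived_val].
HB.instance Definition _ := [Choice of derived by <:].
HB.instance Definition _ :=
  SubChoice_isSubGroup.Build _ _ derived derived_closed.

Definition ab_equiv : rel G := fun x y => derived_pred (x / y).

Fact ab_equiv_refl : reflexive ab_equiv.
Proof. by move=> x; rewrite /ab_equiv mulgV derived1. Qed.

Fact ab_equiv_sym : symmetric ab_equiv.
Proof.
by move=> x y; apply/idP/idP => /derivedV; rewrite /ab_equiv invgF.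
Qed.

Fact ab_equiv_trans : transitive ab_equiv.
Proof.
move=> y x z Dxy Dyz; rewrite /ab_equiv -[x](mulgVK y) -mulgA.
exact: derivedM.
Qed.

Canonical ab_equiv_rel :=
  EquivRel ab_equiv ab_equiv_refl ab_equiv_sym ab_equiv_trans.

Definition abel : Type := {eq_quot ab_equiv}.

HB.instance Definition _ := Choice.on abel.
HB.instance Definition _ := EqQuotient.on abel.

Definition abel_pi (x : G) : abel := \pi_abel x.

Lemma abel_piP x y : reflect (abel_pi x = abel_pi y) (derived_pred (x / y)).
Proof. by rewrite -[derived_pred _]/(ab_equiv x y) -eqmodE; apply: eqP. Qed.

Lemma abel_reprK (a : abel) : abel_pi (repr a) = a.
Proof. exact: reprK. Qed.

Lemma abel_repr x : derived_pred (repr (abel_pi x) / x).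
Proof. by apply/abel_piP; rewrite abel_reprK. Qed.

Definition abel_zero : abel := abel_pi 1.
Definition abel_opp (a : abel) : abel := abel_pi (repr a)^-1.
Definition abel_add (a b : abel) : abel := abel_pi (repr a * repr b).

Lemma abel_piC x y : abel_pi (x * y) = abel_pi (y * x).
Proof.
apply/abel_piP; have -> : (x * y) / (y * x) = [~ x^-1, y^-1].
  by rewrite /commg /conjg !invgK invgM !mulgA.
exact: derivedR.
Qed.

Lemma abel_addE x y : abel_add (abel_pi x) (abel_pi y) = abel_pi (x * y).
Proof.
apply/abel_piP; set x' := repr _; set y' := repr _.
have -> : (x' * y') / (x * y) = (x' * (y' / y) * x'^-1) * (x' / x).
  by rewrite invgM !mulgA mulgVK.
by rewrite derivedM ?derivedJ ?abel_repr.
Qed.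

Lemma abel_addA : associative abel_add.
Proof.
move=> a b c; rewrite -(abel_reprK a) -(abel_reprK b) -(abel_reprK c).
by rewrite !abel_addE mulgA.
Qed.

Lemma abel_addC : commutative abel_add.
Proof. by move=> a b; apply: abel_piC. Qed.

Lemma abel_add0 : left_id abel_zero abel_add.
Proof. by move=> a; rewrite -(abel_reprK a) abel_addE mul1g. Qed.

Lemma abel_addN : left_inverse abel_zero abel_opp abel_add.
Proof.
by move=> a; rewrite -[X in abel_add _ X]abel_reprK abel_addE mulVg.
Qed.

HB.instance Definition _ :=
  GRing.isZmodule.Build abel abel_addA abel_addC abel_add0 abel_addN.

Lemma abel_piM x y : abel_pi (x * y) = (abel_pi x + abel_pi y)%R.
Proof. by rewrite -abel_addE. Qed.
End Derived.

Section Conjugation.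
Local Open Scope group_scope.
Variable G : groupType.
Implicit Types (x y : G) (c d : derived G) (a : abel G) (m : abel (derived G)).

Definition conj_derived x c : derived G :=
  Derived (derivedJ x (valP c)).

Definition conj_act x m : abel (derived G) :=
  abel_pi (conj_derived x (repr m)).

End Conjugation.

Lemma derived_morph (G H : groupType) (f : UMagmaMorphism.type G H) (x : G) :
  derived_pred x -> derived_pred (f x).
Proof.
move=> /asboolP Dx; apply/asboolP; elim: Dx => [|y z|y z _ IHy _ IHz].
- by rewrite gmulf1; apply: comm_span1.
- by rewrite /commg /conjg !(gmulfM, gmulfV); apply: comm_span_gen.
- by rewrite gmulfF; apply: comm_spanF.
Qed.

Section ConjugationAction.
Local Open Scope group_scope.
Variable G : groupType.
Implicit Types (x y : G) (c d : derived G) (a b : abel G).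
Implicit Types m : abel (derived G).

Fact conj_derivedF x : {morph conj_derived x : c d / c / d}.
Proof. by move=> c d; apply/val_inj; rewrite /= !invgM invgK !mulgA mulgVK. Qed.

HB.instance Definition _ x :=
  isGroupMorphism.Build (derived G) (derived G) (conj_derived x)
    (conj_derivedF x).

Lemma conj_actE x c :
  conj_act x (abel_pi c) = abel_pi (conj_derived x c).
Proof.
apply/abel_piP; rewrite -gmulfF; apply: (derived_morph (conj_derived x)).
exact: abel_repr.
Qed.

Lemma conj_act_add x : {morph conj_act x : m m' / (m + m')%R}.
Proof.
move=> m m'; rewrite -(abel_reprK m) -(abel_reprK m') -abel_piM !conj_actE.
by rewrite gmulfM abel_piM.
Qed.

Lemma conj_act1 m : conj_act 1 m = m.
Proof.
rewrite -[in LHS](abel_reprK m) conj_actE -[RHS]abel_reprK; congr abel_pi.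
by apply/val_inj; rewrite /= mul1g invg1 mulg1.
Qed.

Lemma conj_actM x y m : conj_act (x * y) m = conj_act x (conj_act y m).
Proof.
rewrite -(abel_reprK m) (conj_actE y) !conj_actE; congr abel_pi.
by apply/val_inj; rewrite /= invgM !mulgA.
Qed.

Lemma conj_act_derived x m : derived_pred x -> conj_act x m = m.
Proof.
move=> Dx; rewrite -(abel_reprK m) conj_actE; set c := repr m.
pose d : derived G := Derived Dx.
have -> : conj_derived x c = d * c * d^-1 by apply/val_inj.
by rewrite abel_piC mulgA mulVg mul1g.
Qed.

Lemma conj_act_abel x y m :
  abel_pi x = abel_pi y -> conj_act x m = conj_act y m.
Proof.
by move=> /abel_piP Dxy; rewrite -[x](mulgVK y) conj_actM conj_act_derived.
Qed.

Definition abel_act (a : Algebra.to_multiplicative (abel G)) m : abel (derived G) :=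
  conj_act (repr (a : abel G)) m.

Lemma abel_actE x m : abel_act (abel_pi x) m = conj_act x m.
Proof. by apply: conj_act_abel; rewrite abel_reprK. Qed.

Fact abel_act_add (a : Algebra.to_multiplicative (abel G)) :
  {morph abel_act a : m m' / (m + m')%R}.
Proof. exact: conj_act_add. Qed.

Fact abel_act1 m : abel_act 1 m = m.
Proof. by rewrite [1]/(abel_pi 1) abel_actE conj_act1. Qed.

Fact abel_actM (a b : Algebra.to_multiplicative (abel G)) m :
  abel_act (a * b) m = abel_act a (abel_act b m).
Proof.
rewrite -[a](abel_reprK (a : abel G)) -[b](abel_reprK (b : abel G)).
by rewrite [_ * _]abel_addE !abel_actE conj_actM.
Qed.

(* x.[c] = [x c x^-1] for the class of x in G^ab: see abel_actE, conj_actE. *)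
Definition derived_gaction :
    gaction (Algebra.to_multiplicative (abel G)) (abel (derived G)) :=
  GAction abel_act_add abel_act1 abel_actM.
End ConjugationAction.

Section Pullback.
Variables (G H : groupType) (V : zmodType).
Variable f : UMagmaMorphism.type H G.
Variable to : gaction G V.

Fact pull_add x : {morph to (f x) : v w / v + w}.
Proof. exact: gact_add. Qed.

Fact pull_one v : to (f 1%g) v = v.
Proof. by rewrite gmulf1 gact_one. Qed.

Fact pull_mul x y v : to (f (x * y)%g) v = to (f x) (to (f y) v).
Proof. by rewrite gmulfM gact_mul. Qed.

Definition gaction_pull : gaction H V := GAction pull_add pull_one pull_mul.
End Pullback.

(* Words in the generators and their inverses: the letter (x, true) stands for
   x and (x, false) for x^-1. *)
Definition word (T : Type) : Type := seq (T * bool).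

Definition word_inv (T : Type) (w : word T) : word T :=
  rev [seq (l.1, ~~ l.2) | l <- w].

Section Presentation.
Variables (T : choiceType) (R : word T -> Prop).
Implicit Types u v w : word T.

Inductive pres_eq : word T -> word T -> Prop :=
| pres_refl w : pres_eq w w
| pres_sym v w of pres_eq v w : pres_eq w v
| pres_trans u v w of pres_eq u v & pres_eq v w : pres_eq u w
| pres_cat v v' w w' of pres_eq v v' & pres_eq w w' :
    pres_eq (v ++ w) (v' ++ w')
| pres_cancel x b : pres_eq [:: (x, b); (x, ~~ b)] [::]
| pres_rel r of R r : pres_eq r [::].

Definition pres_equiv : rel (word T) := fun v w => `[< pres_eq v w >].

Fact pres_equiv_refl : reflexive pres_equiv.
Proof. by move=> w; apply/asboolP/pres_refl. Qed.

Fact pres_equiv_sym : symmetric pres_equiv.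
Proof. by move=> v w; apply/asboolP/asboolP; apply: pres_sym. Qed.

Fact pres_equiv_trans : transitive pres_equiv.
Proof.
by move=> v u w /asboolP uv /asboolP vw; apply/asboolP; apply: pres_trans vw.
Qed.

HB.instance Definition _ := Choice.on (word T).

Canonical pres_equiv_rel :=
  EquivRel pres_equiv pres_equiv_refl pres_equiv_sym pres_equiv_trans.

Definition presented : Type := {eq_quot pres_equiv}.

HB.instance Definition _ := Choice.on presented.
HB.instance Definition _ := EqQuotient.on presented.

Definition pres_pi w : presented := \pi_presented w.

Lemma pres_piP v w : pres_pi v = pres_pi w <-> pres_eq v w.
Proof.
split=> [/eqP|vw]; last by apply/eqP; rewrite eqmodE; apply/asboolP.
by rewrite eqmodE => /asboolP.
Qed.

Lemma pres_reprK (a : presented) : pres_pi (repr a) = a.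
Proof. exact: reprK. Qed.

Lemma pres_repr w : pres_eq (repr (pres_pi w)) w.
Proof. by apply/pres_piP; rewrite pres_reprK. Qed.

Lemma pres_eq_invr w : pres_eq (w ++ word_inv w) [::].
Proof.
elim: w => [|[x b] w IHw]; first exact: pres_refl.
rewrite /word_inv /= rev_cons -cats1 catA -cat1s -/(word_inv w).
apply: pres_trans (pres_cancel x b); rewrite -[[:: (x, b); _]]cat1s.
apply: pres_cat; first exact: pres_refl.
by rewrite -[X in pres_eq _ X]cat0s; apply: pres_cat IHw (pres_refl _).
Qed.

Lemma word_invK : involutive (@word_inv T).
Proof.
move=> w; rewrite /word_inv map_rev revK -map_comp -[RHS]map_id.
by apply: eq_map => -[x b] /=; rewrite negbK.
Qed.

Lemma pres_eq_invl w : pres_eq (word_inv w ++ w) [::].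
Proof. by rewrite -[X in _ ++ X]word_invK; apply: pres_eq_invr. Qed.

Definition pres_mul (a b : presented) : presented :=
  pres_pi (repr a ++ repr b).
Definition pres_inv (a : presented) : presented :=
  pres_pi (word_inv (repr a)).

Lemma pres_mulE v w : pres_mul (pres_pi v) (pres_pi w) = pres_pi (v ++ w).
Proof. by apply/pres_piP; apply: pres_cat; apply: pres_repr. Qed.

Fact pres_mulA : associative pres_mul.
Proof.
move=> a b c; rewrite -(pres_reprK a) -(pres_reprK b) -(pres_reprK c).
by rewrite !pres_mulE catA.
Qed.

Fact pres_mul1 : left_id (pres_pi [::]) pres_mul.
Proof. by move=> a; rewrite -(pres_reprK a) pres_mulE. Qed.

Fact pres_mulr1 : right_id (pres_pi [::]) pres_mul.
Proof. by move=> a; rewrite -(pres_reprK a) pres_mulE cats0. Qed.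

Fact pres_mulV : left_inverse (pres_pi [::]) pres_inv pres_mul.
Proof.
move=> a; rewrite -[X in pres_mul _ X]pres_reprK pres_mulE.
by apply/pres_piP; apply: pres_eq_invl.
Qed.

Fact pres_mulrV : right_inverse (pres_pi [::]) pres_inv pres_mul.
Proof.
move=> a; rewrite -[X in pres_mul X _]pres_reprK pres_mulE.
by apply/pres_piP; apply: pres_eq_invr.
Qed.

HB.instance Definition _ := isGroup.Build presented
  pres_mulA pres_mul1 pres_mulr1 pres_mulV pres_mulrV.

Definition pres_gen (x : T) : presented := pres_pi [:: (x, true)].
End Presentation.

Section Surface.
Variable g : nat.

Fact pair_ord_subproof (i : 'I_g) (b : bool) : (i.*2 + b < 2 * g)%N.
Proof. by case: b; rewrite mul2n ?addn1 ?addn0 ?ltn_Sdouble ?ltn_double. Qed.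

(* The 0-based indices 2i and 2i + 1 of the i-th pair of generators. *)
Definition pair_ord (i : 'I_g) (b : bool) : 'I_(2 * g) :=
  Ordinal (pair_ord_subproof i b).

Definition comm_word (T : Type) (x y : T) : word T :=
  [:: (x, false); (y, false); (x, true); (y, true)].

Definition surface_relator : word 'I_(2 * g) :=
  flatten [seq comm_word (pair_ord i false) (pair_ord i true) | i <- enum 'I_g].

Definition surface_group : groupType :=
  presented (fun r : word 'I_(2 * g) => r = surface_relator).

Definition surface_gen (i : 'I_(2 * g)) : surface_group := pres_gen _ i.

Definition H1_lattice : groupType := Algebra.to_multiplicative 'rV[int]_(2 * g).

(* The isomorphism Z^2g -> pi^ab given by the classes of the generators. *)
Definition H1_map (v : 'rV[int]_(2 * g)) : abel surface_group :=
  \sum_i abel_pi (surface_gen i) *~ v ord0 i.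

Fact H1_map_is_additive : zmod_morphism H1_map.
Proof.
move=> v w; rewrite /H1_map -sumrB; apply: eq_bigr => i _.
by rewrite !mxE mulrzBr.
Qed.

HB.instance Definition _ :=
  GRing.isZmodMorphism.Build 'rV[int]_(2 * g) (abel surface_group) H1_map
    H1_map_is_additive.

Definition surface_gaction : gaction H1_lattice (abel (derived surface_group)) :=
  gaction_pull (Algebra.to_fmultiplicative H1_map) (derived_gaction surface_group).

Definition surface_module : lmodType (gring H1_lattice) :=
  gmod surface_gaction.

Definition basis_pair (i : 'I_g) : {ffun 'I_2 -> 'rV[int]_(2 * g)} :=
  [ffun k : 'I_2 => delta_mx ord0 (pair_ord i (k == 1 :> nat))].

(* x_1 /\ x_2 + ... + x_(2g-1) /\ x_2g, the generator of the Z that is killed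
   in (/\^2 Z^2g) / Z. *)
Definition omega : extpow 2 'rV[int]_(2 * g) :=
  \sum_(i < g) wedge (basis_pair i).
End Surface.

(* Main.v *)
(* Let L = Z[Z^2g] with variables t_i. By Fox calculus the module
   M = [pi, pi]^ab is Z_1 / (L r), where Z_1 is the kernel of
   L^2g -> L, e_i |-> t_i - 1, and r is the Fox derivative of the relator: the
   Reidemeister-Schreier map h e_i |-> s(h) x_i s(h x_i)^-1 inverts the Fox
   derivative. The Koszul complex K on the t_i - 1 is exact, so M has the free
   resolution ... -> K_5 -> K_4 -> K_3 (+) L -> K_2, where 1 in L goes to a
   lift of r to K_2. The bar complex of a free module is acyclic, so zigzags in
   the double complex of chains with coefficients in this resolution identify
   the homology of M with that of the coinvariants of the resolution. There
   every differential vanishes, except for L -> K_2, which becomes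
   1 |-> - omega in /\^2 Z^2g; as omega is unimodular, this is injective. *)
Require Import Defs.
From HB Require Import structures.
From mathcomp Require Import all_boot all_algebra.
From mathcomp Require Import perm finmap boolp monalg ring.

Set Implicit Arguments.
Unset Strict Implicit.
Unset Printing Implicit Defensive.

Import GRing.Theory Num.Theory.
Local Open Scope ring_scope.
Local Open Scope quotient_scope.

(** * Additive maps on free abelian groups, and chains *)

(** Three obstacles shape the argument. First, the section of pi -> Z^2g is a choice, not a
    homomorphism, so the Reidemeister-Schreier map fails to be L-linear by a 2-cocycle; the error
    depends only on the image in L of the argument, hence vanishes on Z_1. Second, exactness of the
    Koszul complex asks that t_n - 1 be a nonzerodivisor modulo the earlier t_i - 1. Killing those
    means setting t_i = 1, and the result sits inside L, where a nonzero a with t_n a = a would have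
    infinite support. The same fact makes l |-> l r injective, as the first entry of r is a unit
    times 1 - t_1; this uses g >= 1. Third, the coinvariants of K_m are not matched with exterior
    powers basis by basis: both are free abelian of rank binomial(2g, m), and Z^n modulo a
    unimodular vector is Z^(n-1) whichever vector it is, so unimodularity is checked once in K_2 and
    once in /\^2. Non-freeness comes from H_1: it is /\^3 Z^2g, nonzero once 2g >= 3, while a free
    module has no homology in positive degrees. *)

Section MalgExtension.
Variables (T : choiceType) (V W : zmodType).

Lemma malg_additive_eq (f f' : {additive {malg V[T]} -> W}) :
  (forall t v, f << v *g t >> = f' << v *g t >>) -> f =1 f'.
Proof.
move=> ff' c; rewrite (monalgE c) !raddf_sum.
by apply: eq_bigr => t _; apply: ff'.
Qed.

Variable phi : T -> {additive V -> W}.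

(** The universal property of a direct sum of copies of [V] indexed by [T]. Most maps out of chains
    and out of the group ring are built this way and compared on generators by
    [malg_additive_eq]. *)
Definition malg_ext (c : {malg V[T]}) : W := \sum_(t <- msupp c) phi t c@_t.

Lemma malg_extw (d : {fset T}) c : (msupp c `<=` d)%fset ->
  malg_ext c = \sum_(t <- d) phi t c@_t.
Proof.
move=> le; rewrite /malg_ext (big_fset_incl _ le) //= => t _ /mcoeff_outdom ->.
exact: raddf0.
Qed.

Fact malg_ext_is_additive : zmod_morphism malg_ext.
Proof.
move=> c c'; rewrite (malg_extw (msuppB_le c c')).
rewrite (malg_extw (fsubsetUl _ (msupp c'))) (malg_extw (fsubsetUr (msupp c) _)).
by rewrite -sumrB; apply/eq_bigr=> t _; rewrite mcoeffB raddfB.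
Qed.

HB.instance Definition _ :=
  GRing.isZmodMorphism.Build {malg V[T]} W malg_ext malg_ext_is_additive.

Lemma malg_extU t v : malg_ext << v *g t >> = phi t v.
Proof. by rewrite (malg_extw msuppU_le) big_seq_fset1 mcoeffUU. Qed.
End MalgExtension.

Definition additive_of (V W : zmodType) (f : V -> W) (fB : zmod_morphism f) :
    {additive V -> W} :=
  HB.pack f (GRing.isZmodMorphism.Build V W f fB).

Section CoefficientMap.
Variables (V W : zmodType) (f : {additive V -> W}) (T : choiceType).

Fact coefmap_gen_is_additive t : zmod_morphism (fun v => << f v *g t >> : {malg W[T]}).
Proof. by move=> v w; rewrite raddfB monalgUB. Qed.

Definition coefmap : {malg V[T]} -> {malg W[T]} :=
  malg_ext (fun t => additive_of (coefmap_gen_is_additive t)).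

HB.instance Definition _ := GRing.Additive.copy coefmap
  (malg_ext (fun t => additive_of (coefmap_gen_is_additive t))).

Lemma coefmapU t v : coefmap << v *g t >> = << f v *g t >>.
Proof. exact: malg_extU. Qed.

Lemma coefmap_coef c t : (coefmap c)@_t = f c@_t.
Proof.
suff: mcoeff t \o coefmap =1 f \o mcoeff t by apply.
apply: malg_additive_eq => u v /=; rewrite coefmapU !mcoeffU.
by rewrite raddfMn.
Qed.

Lemma coefmap_lift (c : {malg W[T]}) :
  (forall t, exists v, f v = c@_t) -> exists c', coefmap c' = c.
Proof.
move=> /choice[h hP]; exists (\sum_(t <- msupp c) << h t *g t >>).
rewrite raddf_sum [RHS]monalgE; apply: eq_bigr => t _.
by rewrite /= coefmapU hP.
Qed.

Lemma coefmap_ker (c : {malg V[T]}) t : coefmap c = 0 -> f c@_t = 0.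
Proof. by rewrite -coefmap_coef => ->; rewrite mcoeff0. Qed.
End CoefficientMap.

Arguments coefmap {V W} f {T} c.

Section Bar.
Variable G : groupType.

Section AnyModule.
Variable M : lmodType (gring G).
Implicit Types v : M.

Lemma bdryU k (t : {ffun 'I_k.+1 -> G}) v : bdry << v *g t >> = bdry_gen t v.
Proof.
rewrite (bdryw msuppU_le) big_seq_fset1 mcoeffUU //.
Qed.

Definition no_letter : {ffun 'I_0 -> G} := [ffun=> 1%g].

Lemma ffun_nil (t : {ffun 'I_0 -> G}) : t = no_letter.
Proof. by apply/ffunP; case. Qed.

Lemma chain0E (c : chain M 0) : c = << c@_no_letter *g no_letter >>.
Proof.
by apply/malgP => t; rewrite (ffun_nil t) mcoeffUU.
Qed.

(** The sign in the boundary is a scalar of the group ring; as an integer multiple it passes through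
    every additive map, equivariant or not. *)
Lemma monalgU_sign (T : choiceType) n v (t : T) :
  << (-1) ^+ n *: v *g t >> = << v *g t >> *~ (-1) ^+ n :> {malg M[T]}.
Proof.
rewrite -signr_odd scaler_sign -[in RHS]signr_odd.
by case: (odd n); rewrite ?expr0 ?expr1 ?mulr1z // monalgUN mulrN1z.
Qed.

Lemma bdry_genE k (t : {ffun 'I_k.+1 -> G}) v :
  bdry_gen t v = << gelt ((t ord0)^-1)%g *: v *g face_first t >>
  + \sum_(i < k) << v *g face_mid t i >> *~ (-1) ^+ i.+1
  + << v *g face_last t >> *~ (-1) ^+ k.+1.
Proof.
rewrite /bdry_gen monalgU_sign; congr (_ + _ + _).
by apply: eq_bigr => i _; rewrite monalgU_sign.
Qed.

End AnyModule.

(** The first face alone acts on the coefficient, and it does so by a single group element. *)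
Lemma bdry_coefmap (M N : lmodType (gring G)) (f : {additive M -> N}) k
    (c : chain M k.+1) :
    (forall g v, f (gelt g *: v) = gelt g *: f v) ->
  bdry (coefmap f c) = coefmap f (bdry c).
Proof.
move=> fZ; suff: @bdry G N k \o coefmap f =1 coefmap f \o @bdry G M k by apply.
apply: malg_additive_eq => t v /=; rewrite coefmapU !bdryU !bdry_genE.
rewrite !raddfD /= raddf_sum /= coefmapU fZ raddfMz /= coefmapU.
by congr (_ + _ + _); apply: eq_bigr => i _; rewrite raddfMz /= coefmapU.
Qed.

End Bar.

(** * The bar complex of a free module *)

Section Cons.
Variable G : groupType.

Definition tcons k (h : G) (t : {ffun 'I_k -> G}) : {ffun 'I_k.+1 -> G} :=
  [ffun i => if unlift ord0 i is Some j then t j else h].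

Lemma tcons0 k h (t : {ffun 'I_k -> G}) : tcons h t ord0 = h.
Proof. by rewrite ffunE unlift_none. Qed.

Lemma tconsS k h (t : {ffun 'I_k -> G}) i : tcons h t (lift ord0 i) = t i.
Proof. by rewrite ffunE liftK. Qed.

Lemma tcons_surj k (t : {ffun 'I_k.+1 -> G}) : t = tcons (t ord0) (face_first t).
Proof.
apply/ffunP => i; rewrite ffunE; case: unliftP => [j ->|-> //].
by rewrite ffunE.
Qed.

Lemma face_first_tcons k h (t : {ffun 'I_k -> G}) : face_first (tcons h t) = t.
Proof. by apply/ffunP => i; rewrite ffunE tconsS. Qed.

Lemma lift_max_lift0 k (i : 'I_k) :
  lift ord_max (lift ord0 i) = lift ord0 (lift ord_max i).
Proof. by apply/val_inj; rewrite [LHS]lift_max lift0 [RHS]lift0 lift_max. Qed.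

Lemma lift_max0 k : lift (@ord_max k.+1) ord0 = ord0.
Proof. exact/val_inj. Qed.

Lemma face_last_tcons k h (t : {ffun 'I_k.+1 -> G}) :
  face_last (tcons h t) = tcons h (face_last t).
Proof.
apply/ffunP => i; rewrite ffunE; case: (unliftP ord0 i) => [j|] ->.
  by rewrite lift_max_lift0 !tconsS ffunE.
by rewrite lift_max0 !tcons0.
Qed.

Lemma face_mid0_tcons k h (t : {ffun 'I_k.+1 -> G}) :
  face_mid (tcons h t) ord0 = tcons (h * t ord0)%g (face_first t).
Proof.
apply/ffunP => i; rewrite ffunE ltn0; case: (unliftP ord0 i) => [j|] ->.
  by rewrite eq_sym (negbTE (neq_lift _ _)) !tconsS ffunE.
by rewrite eqxx lift_max0 !tcons0 tconsS.
Qed.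

Lemma face_midS_tcons k h (t : {ffun 'I_k.+1 -> G}) (j : 'I_k) :
  face_mid (tcons h t) (lift ord0 j) = tcons h (face_mid t j).
Proof.
apply/ffunP => i; rewrite ffunE; case: (unliftP ord0 i) => [l|] ->.
  by rewrite lift_max_lift0 !tconsS (inj_eq (@lift_inj _ _)) ffunE.
by rewrite lift_max0 !tcons0.
Qed.

Variable V : zmodType.

Fact tconsmap_gen_is_additive k h (t : {ffun 'I_k -> G}) :
  zmod_morphism (fun v => << v *g tcons h t >> : {malg V[{ffun 'I_k.+1 -> G}]}).
Proof. by move=> v w; rewrite monalgUB. Qed.

Definition tconsmap k h :
    {malg V[{ffun 'I_k -> G}]} -> {malg V[{ffun 'I_k.+1 -> G}]} :=
  malg_ext (fun t => additive_of (tconsmap_gen_is_additive h t)).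

HB.instance Definition _ k h := GRing.Additive.copy (@tconsmap k h)
  (malg_ext (fun t => additive_of (tconsmap_gen_is_additive h t))).

Lemma tconsmapU k h (t : {ffun 'I_k -> G}) v :
  tconsmap h << v *g t >> = << v *g tcons h t >>.
Proof. exact: malg_extU. Qed.
End Cons.

Section Augmentation.
Variable G : groupType.

Definition aug : gring G -> int := malg_ext (fun _ : G => (idfun : {additive int -> int})).

HB.instance Definition _ := GRing.Additive.copy aug (malg_ext (fun _ : G => (idfun : {additive int -> int}))).

Lemma augZ n h : aug << n *g h >> = n.
Proof. by rewrite /aug malg_extU. Qed.

Lemma augU h : aug (gelt h) = 1.
Proof. exact: augZ. Qed.

Fact aug_is_monoid_morphism : monoid_morphism aug.
Proof.
split=> [|a b]; first exact: augU.
elim/(@gr_ind G): a => [|a1 a2 IH1 IH2|n x]; first by rewrite mul0r raddf0 mul0r.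
  by rewrite mulrDl !raddfD /= IH1 IH2 mulrDl.
elim/(@gr_ind G): b => [|b1 b2 IH1 IH2|m y]; first by rewrite mulr0 raddf0 mulr0.
  by rewrite mulrDr !raddfD /= IH1 IH2 mulrDr.
by rewrite [_ * _]gr_mulUU !augZ.
Qed.

HB.instance Definition _ :=
  GRing.isMonoidMorphism.Build (gring G) int aug aug_is_monoid_morphism.
End Augmentation.

Section FreeAcyclic.
Variable G : groupType.
Variables (F : lmodType (gring G)) (I : choiceType) (b : I -> F).
Variable coord : {additive F -> {malg (gring G)[I]}}.
Hypothesis coordZ : forall a i, coord (a *: b i) = << a *g i >>.
Hypothesis coordK : forall v, v = \sum_(i <- msupp (coord v)) (coord v)@_i *: b i.

Lemma gr_generated (a : gring G) : a = \sum_(h <- msupp a) gelt h *~ a@_h.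
Proof.
rewrite [LHS](@monalgE G int a); apply: eq_bigr => h _.
rewrite /gelt -[RHS](raddfMz (@mkmalgU G int h)).
by rewrite intz.
Qed.

Lemma free_additive_eq (W : zmodType) k (f f' : {additive chain F k -> W}) :
    (forall h i t, f << gelt h *: b i *g t >> = f' << gelt h *: b i *g t >>) ->
  f =1 f'.
Proof.
move=> ff'; apply: malg_additive_eq => t v; rewrite (coordK v).
rewrite !raddf_sum; apply: eq_bigr => i _.
rewrite (gr_generated _@_i) scaler_suml !raddf_sum; apply: eq_bigr => h _ /=.
by rewrite -scalerMzl !raddfMz /= ff'.
Qed.

Fact contraction_int_is_additive k (t : {ffun 'I_k -> G}) i h :
  zmod_morphism (fun n : int => << b i *~ n *g tcons h^-1 t >> : chain F k.+1).
Proof. by move=> n m; rewrite mulrzBr monalgUB. Qed.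

Definition contraction_coord k (t : {ffun 'I_k -> G}) i :
    {additive gring G -> chain F k.+1} :=
  malg_ext (fun h => additive_of (contraction_int_is_additive t i h)).

Definition contraction_vec k (t : {ffun 'I_k -> G}) :
    {additive F -> chain F k.+1} :=
  malg_ext (contraction_coord t) \o coord.

(* h b_i (x) [t] |-> b_i (x) [h^-1 | t] *)
Definition contraction k : chain F k -> chain F k.+1 :=
  malg_ext (@contraction_vec k).

HB.instance Definition _ k :=
  GRing.Additive.copy (@contraction k) (malg_ext (@contraction_vec k)).

Lemma contractionU k h i (t : {ffun 'I_k -> G}) :
  contraction << gelt h *: b i *g t >> = << b i *g tcons h^-1 t >>.
Proof.
by rewrite [LHS]malg_extU /= coordZ [LHS]malg_extU [LHS]malg_extU /= mulr1z.
Qed.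

(** These are the faces that leave the coefficient alone. Prepending a letter shifts their index by
    one and so flips their sign. *)
Definition bdry_rest k (t : {ffun 'I_k.+1 -> G}) (v : F) : chain F k :=
  \sum_(i < k) << v *g face_mid t i >> *~ (-1) ^+ i.+1
  + << v *g face_last t >> *~ (-1) ^+ k.+1.

Lemma bdry_genS k (t : {ffun 'I_k.+1 -> G}) (v : F) :
  bdry_gen t v = << gelt ((t ord0)^-1)%g *: v *g face_first t >> + bdry_rest t v.
Proof. by rewrite bdry_genE addrA. Qed.

Lemma bdry_tcons k h (t : {ffun 'I_k.+1 -> G}) (v : F) :
  bdry << v *g tcons h t >> = << gelt h^-1%g *: v *g t >>
    - << v *g tcons (h * t ord0)%g (face_first t) >>
    - tconsmap h (bdry_rest t v).
Proof.
rewrite bdryU bdry_genS tcons0 face_first_tcons -addrA; congr (_ + _).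
rewrite /bdry_rest big_ord_recl face_mid0_tcons -addrA expr1 mulrN1z; congr (_ + _).
rewrite (raddfD (tconsmap h)) opprD (raddf_sum (tconsmap h)) -sumrN.
congr (_ + _).
  apply: eq_bigr => i _; rewrite face_midS_tcons lift0 raddfMz /= tconsmapU.
  by rewrite [in LHS]exprS mulN1r mulrNz.
by rewrite raddfMz /= tconsmapU face_last_tcons exprS mulN1r mulrNz.
Qed.

Lemma contraction_rest k h i (t : {ffun 'I_k.+1 -> G}) :
  contraction (bdry_rest t (gelt h *: b i)) = tconsmap h^-1%g (bdry_rest t (b i)).
Proof.
rewrite /bdry_rest !raddfD !raddf_sum !raddfMz /= contractionU tconsmapU.
apply: (f_equal2 +%R); last by [].
by apply: eq_bigr => j _; rewrite !raddfMz /= contractionU tconsmapU.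
Qed.

Lemma geltM (g h : G) : gelt (g * h)%g = gelt g * gelt h.
Proof. by rewrite /gelt [RHS]gr_mulUU. Qed.

(** On h b_i (x) [t], the first face of the contraction gives the generator back. Its next face,
    which multiplies h^-1 by t_0, cancels against the contraction of the first face, and the
    remaining faces cancel by the sign shift. *)
Lemma contractionE k (c : chain F k.+1) :
  bdry (contraction c) + contraction (bdry c) = c.
Proof.
suff: (@bdry _ _ _ \o @contraction k.+1) \+ (@contraction k \o @bdry _ _ _) =1 idfun.
  by apply.
apply: free_additive_eq => h i t /=.
rewrite contractionU bdry_tcons invgK bdryU bdry_genS (raddfD (@contraction k)) /=.
rewrite scalerA -geltM contractionU contraction_rest invgM invgK.
by rewrite -[_ - _ - _]addrA -opprD addrNK.
Qed.

Lemma free_exact k (c : chain F k.+1) : bdry c = 0 -> exists c', c = bdry c'.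
Proof.
by move=> c0; exists (contraction c); rewrite -{1}(contractionE c) c0 raddf0 addr0.
Qed.

Fact augmented_coord_is_additive i : zmod_morphism (fun a : gring G => b i *~ aug a).
Proof. by move=> x y; rewrite raddfB mulrzBr. Qed.

(** Projection onto the integer span of the basis, a copy of the coinvariants inside [F]. *)
Definition augmented : {additive F -> F} :=
  malg_ext (fun i => additive_of (augmented_coord_is_additive i)) \o coord.

Lemma augmentedZ a i : augmented (a *: b i) = b i *~ aug a.
Proof. by rewrite /augmented /= coordZ [LHS]malg_extU. Qed.

(** In degree 0 the homotopy joins the identity to this projection instead of to zero, which is why
    only the coinvariants survive there. *)
Lemma contraction0E (c : chain F 0) :
  bdry (contraction c) = c - coefmap augmented c.
Proof.
suff: @bdry _ _ _ \o @contraction 0 =1 idfun \- coefmap augmented by apply.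
apply: free_additive_eq => h i t /=.
rewrite contractionU bdryU bdry_genE tcons0 face_first_tcons invgK.
rewrite coefmapU augmentedZ augU mulr1z big_ord0 addr0 expr1 mulrN1z.
by rewrite [face_last _]ffun_nil [t]ffun_nil.
Qed.

Lemma augmented_bdry (c : chain F 1) : coefmap augmented (bdry c) = 0.
Proof.
suff: coefmap augmented \o @bdry _ _ _ =1 (\0 : chain F 1 -> chain F 0) by apply.
apply: free_additive_eq => h i t /=.
rewrite bdryU bdry_genE big_ord0 addr0 raddfD /=.
rewrite expr1 mulrN1z raddfN /= !coefmapU scalerA -geltM !augmentedZ !augU.
by rewrite [face_last _]ffun_nil [face_first _]ffun_nil subrr.
Qed.

Hypothesis mulgC : forall x y : G, (x * y = y * x)%g.

Fact scale_is_additive (a : gring G) : zmod_morphism (fun v : F => a *: v).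
Proof. by move=> v w; rewrite scalerBr. Qed.

(* Every chain is a sum of translates of contractions; translation by an
   element of a commutative group commutes with the boundary. *)
Lemma bdry_bdry_contraction k :
    (forall x : chain F k.+1, bdry (bdry (contraction x)) = 0) ->
  forall c : chain F k.+2, bdry (bdry c) = 0.
Proof.
move=> ddS c.
suff: @bdry _ F _ \o @bdry _ F _ =1 (\0 : chain F k.+2 -> chain F k) by apply.
apply: free_additive_eq => h i t /=.
pose u := additive_of (scale_is_additive (gelt h)).
have uZ g v : u (gelt g *: v) = gelt g *: u v.
  by rewrite /= !scalerA -!geltM mulgC.
have -> : << gelt h *: b i *g t >> =
    coefmap u (contraction << gelt (t ord0)^-1%g *: b i *g face_first t >>).
  by rewrite contractionU coefmapU invgK -tcons_surj.
by rewrite !bdry_coefmap // ddS raddf0.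
Qed.

(** The homotopy s replaces the simplicial identities: from ds + sd = 1 follows dds = d - (ds)d, and
    (ds)d = d - s(dd) = d by induction. In the lowest degree [contraction0E] and [augmented_bdry]
    play this part. *)
Lemma free_bdry_bdry k (c : chain F k.+2) : bdry (bdry c) = 0.
Proof.
elim: k c => [|k IHk]; apply: bdry_bdry_contraction => x.
all: have /(canRL (addrK _)) -> := contractionE x; rewrite raddfB /=.
  by rewrite contraction0E augmented_bdry subr0 subrr.
have E : bdry x = bdry (contraction (bdry x)).
  rewrite -[LHS](contractionE (bdry x)) IHk.
  by rewrite [contraction 0](raddf0 (@contraction k)) addr0.
by rewrite -E subrr.
Qed.
End FreeAcyclic.

(** Uniqueness of coordinates forces the chosen coordinate function to be additive. *)
Lemma free_module_coord (R : nzRingType) (M : lmodType R) : free_module M ->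
  exists (I : choiceType) (b : I -> M) (coord : {additive M -> {malg R[I]}}),
    (forall a i, coord (a *: b i) = << a *g i >>) /\
    (forall v, v = \sum_(i <- msupp (coord v)) (coord v)@_i *: b i).
Proof.
move=> [I [b /[dup] bP /choice[coord cP]]].
have b_is_additive i : zmod_morphism (fun a : R => a *: b i).
  by move=> x y; rewrite scalerBl.
pose comb := malg_ext (fun i => additive_of (b_is_additive i)).
have combE c : comb c = \sum_(i <- msupp c) c@_i *: b i by [].
have coordU c : coord (comb c) = c by apply: (cP _).2; rewrite combE.
have coordK v : v = comb (coord v) by rewrite combE; apply: (cP _).1.
have coordB : zmod_morphism coord.
  by move=> v w; rewrite {1}(coordK v) {1}(coordK w) -raddfB coordU.
exists I, b, (additive_of coordB); split=> [a i|v] /=; last exact: coordK.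
by rewrite -[RHS]coordU; congr coord; rewrite /comb malg_extU.
Qed.

Section RowModule.
Variables (G : groupType) (N : nat).
Local Notation F := 'rV[gring G]_N.

Definition row_coord (v : F) : {malg (gring G)['I_N]} := \sum_i << v ord0 i *g i >>.

Fact row_coord_is_additive : zmod_morphism row_coord.
Proof.
by move=> v w; rewrite /row_coord -sumrB; apply: eq_bigr => i _; rewrite !mxE monalgUB.
Qed.

HB.instance Definition _ := GRing.isZmodMorphism.Build F
  {malg (gring G)['I_N]} row_coord row_coord_is_additive.

Lemma row_coord_coef v i : (row_coord v)@_i = v ord0 i.
Proof.
rewrite /row_coord raddf_sum (bigD1 i) //= mcoeffUU big1 ?addr0 // => j /negbTE ji.
by rewrite mcoeffU ji.
Qed.

Lemma row_coordZ a i : row_coord (a *: delta_mx ord0 i) = << a *g i >>.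
Proof.
apply/malgP => j; rewrite row_coord_coef mcoeffU !mxE eqxx /= eq_sym.
by case: eqP => _; rewrite ?mulr1 ?mulr0.
Qed.

Lemma row_coordK v :
  v = \sum_(i <- msupp (row_coord v)) (row_coord v)@_i *: delta_mx ord0 i.
Proof.
have scale_is_additive i : zmod_morphism (fun a : gring G => a *: delta_mx ord0 i : F).
  by move=> x y; rewrite scalerBl.
rewrite -[RHS]/(malg_ext (fun i => additive_of (scale_is_additive i)) (row_coord v)).
rewrite /row_coord (raddf_sum (malg_ext _)) {1}(row_sum_delta v).
by apply: eq_bigr => i _; rewrite [RHS]malg_extU.
Qed.

Lemma row_exact k (c : chain F k.+1) : bdry c = 0 -> exists c', c = bdry c'.
Proof. exact: free_exact (@row_coordZ) (@row_coordK) _ _. Qed.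

(** Together with [row_aug_bdry] this identifies the degree 0 homology of a free module with its
    coinvariants; zigzags end there. *)
Lemma row_aug_exact (x : F) : map_mx (@aug G) x = 0 ->
  exists c : chain F 1, bdry c = << x *g no_letter G >>.
Proof.
move=> x0; exists (contraction (fun i => delta_mx ord0 i) (@row_coord) << x *g no_letter G >>).
rewrite (contraction0E (@row_coordZ) (@row_coordK)) coefmapU.
have -> : augmented (fun i => delta_mx ord0 i) (@row_coord) x = 0.
  rewrite /augmented /= [malg_ext _ _]big1 //= => i _; rewrite row_coord_coef.
  by have /matrixP/(_ ord0 i) := x0; rewrite !mxE => ->; rewrite mulr0z.
by rewrite monalgU0 subr0.
Qed.

Lemma row_aug_bdry (c : chain F 1) : map_mx (@aug G) (bdry c)@_(no_letter G) = 0.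
Proof.
suff: (map_mx (@aug G) : {additive F -> 'rV_N}) \o mcoeff (no_letter G) \o @bdry G F 0 =1 (\0 : chain F 1 -> 'rV[int]_N) by apply.
apply: malg_additive_eq => t v /=.
rewrite bdryU bdry_genE big_ord0 addr0 expr1 mulrN1z [face_first t]ffun_nil.
rewrite [face_last t]ffun_nil -monalgUB mcoeffUU; apply/matrixP => i j.
by rewrite !mxE rmorphB rmorphM /= augU mul1r subrr.
Qed.

Hypothesis mulgC : forall x y : G, (x * y = y * x)%g.

Lemma row_bdry_bdry k (c : chain F k.+2) : bdry (bdry c) = 0.
Proof. exact: (free_bdry_bdry (@row_coordZ) (@row_coordK) mulgC). Qed.
End RowModule.

(** * Zigzags and the homology of a resolved module *)

Section Resolution.
Variable G : groupType.
Hypothesis mulgC : forall x y : G, (x * y = y * x)%g.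

Local Notation row n := 'rV[gring G]_n.
Local Notation aug_mx := (map_mx (@aug G)).

Section RowMap.
Variables (m n : nat) (D : 'M[gring G]_(m, n)).

Definition row_map (x : row m) : row n := x *m D.

Fact row_map_is_additive : zmod_morphism row_map.
Proof. by move=> x y; apply: mulmxBl. Qed.

HB.instance Definition _ :=
  GRing.isZmodMorphism.Build (row m) (row n) row_map row_map_is_additive.

Lemma row_mapZ g v : row_map (gelt g *: v) = gelt g *: row_map v.
Proof. by rewrite /row_map scalemxAl. Qed.
End RowMap.

Definition exact_seq (N : nat -> nat) (D : forall k, 'M[gring G]_(N k.+1, N k)) :=
  (forall k, D k.+1 *m D k = 0) /\
  (forall k (x : row (N k.+1)), x *m D k = 0 -> exists y, x = y *m D k.+1).

Lemma exact_seqS N (D : forall k, 'M[gring G]_(N k.+1, N k)) :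
  exact_seq D -> @exact_seq (fun k => N k.+1) (fun k => D k.+1).
Proof. by move=> [DD Dex]; split=> k; [apply: DD | apply: Dex]. Qed.

Lemma coefmap_row_map0 N (D : forall k, 'M[gring G]_(N k.+1, N k)) p
    (c : chain (row (N 2)) p) :
  exact_seq D -> coefmap (row_map (D 0)) (coefmap (row_map (D 1)) c) = 0.
Proof.
move=> [DD _]; apply/malgP => t.
by rewrite !coefmap_coef /= /row_map -mulmxA DD mulmx0 mcoeff0.
Qed.

Lemma coefmap_row_map_exact N (D : forall k, 'M[gring G]_(N k.+1, N k)) p
    (c : chain (row (N 1)) p) :
  exact_seq D -> coefmap (row_map (D 0)) c = 0 ->
  exists c' : chain (row (N 2)) p, c = coefmap (row_map (D 1)) c'.
Proof.
move=> [_ Dex] c0; have [t|c' <-] := @coefmap_lift _ _ (row_map (D 1)) _ c.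
  have /Dex[y ->] : c@_t *m D 0 = 0 by apply: (coefmap_ker t c0).
  by exists y.
by exists c'.
Qed.

Lemma bdry_row_map m n (D : 'M[gring G]_(m, n)) k (c : chain (row m) k.+1) :
  bdry (coefmap (row_map D) c) = coefmap (row_map D) (bdry c).
Proof. exact/bdry_coefmap/row_mapZ. Qed.

(* A zigzag in the double complex of chains with coefficients in the
   resolution, from bidegree (p, 0) to bidegree (0, p). *)
Fixpoint zigzag p : forall N (D : forall k, 'M[gring G]_(N k.+1, N k)),
    chain (row (N 0)) p -> row (N p) -> Prop :=
  match p with
  | 0 => fun N D c x => c = << x *g no_letter G >>
  | p'.+1 => fun N D c x => exists2 c' : chain (row (N 1)) p',
      bdry c = coefmap (row_map (D 0)) c' &
      @zigzag p' (fun k => N k.+1) (fun k => D k.+1) c' x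
  end.

Lemma zigzagB p N (D : forall k, 'M[gring G]_(N k.+1, N k)) c c' x x' :
  @zigzag p N D c x -> @zigzag p N D c' x' -> zigzag D (c - c') (x - x').
Proof.
elim: p N D c c' x x' => [|p IHp] N D c c' x x' /=.
  by move=> -> ->; rewrite monalgUB.
move=> [d dc dx] [d' dc' dx']; exists (d - d'); first by rewrite !raddfB /= dc dc'.
exact: IHp.
Qed.

(** Each new boundary is killed by the next differential, since the two directions commute and the
    boundary squares to zero; exactness of the resolution then lifts it one column further. *)
Lemma zigzag_total p N (D : forall k, 'M[gring G]_(N k.+1, N k)) :
    exact_seq D -> forall c : chain (row (N 0)) p.+1,
    (exists c' : chain (row (N 1)) p, bdry c = coefmap (row_map (D 0)) c') ->
  exists x, zigzag D c x.
Proof.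
elim: p N D => [|p IHp] N D Dex c [c' cc'].
  by exists c'@_(no_letter G); exists c' => //; apply: chain0E.
have [|x c'x] := IHp _ _ (exact_seqS Dex) c'; last by exists x, c'.
apply: coefmap_row_map_exact Dex _.
by rewrite -bdry_row_map -cc' row_bdry_bdry.
Qed.

(** Here the walk goes the other way, and acyclicity of the bar complex of a free module supplies
    each lift. *)
Lemma zigzag_lift p N (D : forall k, 'M[gring G]_(N k.+1, N k)) :
    exact_seq D -> forall x : row (N p.+1), aug_mx (x *m D p) = 0 ->
  exists c, zigzag D c x.
Proof.
elim: p N D => [|p IHp] N D Dex x x0 /=.
  have [c cx] := row_aug_exact x0; exists c, << x *g no_letter G >> => //.
  by rewrite coefmapU.
have [c' [c'' cc'' c''x]] := IHp _ _ (exact_seqS Dex) _ x0.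
have [|c cc'] := @row_exact G _ p (coefmap (row_map (D 0)) c').
  by rewrite bdry_row_map cc'' coefmap_row_map0.
by exists c, c' => //; exists c''.
Qed.

Lemma zigzag_cycle p N (D : forall k, 'M[gring G]_(N k.+1, N k))
    (c : chain (row (N 0)) p.+1) x :
  zigzag D c x -> aug_mx (x *m D p) = 0.
Proof.
elim: p N D c x => [|p IHp] N D c x [c' cc' c'x]; last first.
  exact: (IHp (fun k => N k.+1) (fun k => D k.+1) c' x c'x).
by rewrite -(row_aug_bdry c) cc' c'x coefmapU mcoeffUU.
Qed.

(** The term with [b'] makes the hypothesis that of a boundary in the total complex, a form that
    reproduces itself one column further. For a lift of a chain over the resolved module, this term
    is the part that dies in the module. *)
Lemma zigzag_bdry p N (D : forall k, 'M[gring G]_(N k.+1, N k)) :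
    exact_seq D -> forall c x (b : chain (row (N 0)) p.+1) (b' : chain (row (N 1)) p),
    zigzag D c x -> c = bdry b + coefmap (row_map (D 0)) b' ->
  exists w, aug_mx x = aug_mx (w *m D p).
Proof.
elim: p N D => [|p IHp] N D Dex c x b b' /=.
  move=> -> xE; exists b'@_(no_letter G).
  have -> : x = (bdry b + coefmap (row_map (D 0)) b')@_(no_letter G).
    by rewrite -xE mcoeffUU.
  by rewrite mcoeffD coefmap_coef map_mxD row_aug_bdry add0r.
move=> [c' cc' c'x] cE.
have [|b'' b''E] := @coefmap_row_map_exact _ _ p (c' - bdry b') Dex.
  by rewrite raddfB /= -cc' cE raddfD /= row_bdry_bdry // bdry_row_map add0r subrr.
apply: (IHp _ _ (exact_seqS Dex) c' x b' b'' c'x).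
by rewrite -b''E addrC subrK.
Qed.

Lemma bdry_zigzag p N (D : forall k, 'M[gring G]_(N k.+1, N k)) :
    exact_seq D -> forall c x w, zigzag D c x -> aug_mx x = aug_mx (w *m D p) ->
  exists (b : chain (row (N 0)) p.+1) (b' : chain (row (N 1)) p),
    c = bdry b + coefmap (row_map (D 0)) b'.
Proof.
elim: p N D => [|p IHp] N D Dex c x w /=.
  move=> -> xw; have [|b bE] := @row_aug_exact G _ (x - w *m D 0).
    by rewrite map_mxB xw subrr.
  by exists b, << w *g no_letter G >>; rewrite bE coefmapU monalgUB subrK.
move=> [c' cc' c'x] xw.
have [b' [b'' c'E]] := IHp _ _ (exact_seqS Dex) c' x w c'x xw.
have [|b bE] := @row_exact G _ p (c - coefmap (row_map (D 0)) b').
  by rewrite raddfB /= cc' c'E raddfD /= coefmap_row_map0 // addr0 bdry_row_map subrr.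
by exists b, b'; rewrite -bE subrK.
Qed.
End Resolution.

(** * Isomorphisms of abelian groups, and resolved homology *)

Lemma quot_eq0 (X : zmodType) (B : zmodClosed X) (x : X) :
  (\pi_(Quotient.quot B) x == 0) = (x \in B).
Proof.
rewrite -[0](raddf0 (\pi_(Quotient.quot B))) .
by rewrite -Quotient.idealrBE subr0.
Qed.

Lemma inj_surj_bijective (A B : Type) (f : A -> B) :
  injective f -> (forall y, exists x, f x = y) -> bijective f.
Proof.
move=> f_inj /choice[h hK]; exists h => // x.
by apply: f_inj; rewrite hK.
Qed.

Lemma zmod_iso_trans (U V W : zmodType) : zmod_iso U V -> zmod_iso V W -> zmod_iso U W.
Proof. by move=> [f fb] [h hb]; exists (h \o f); apply: bij_comp. Qed.

Lemma zmod_iso_sym (U V : zmodType) : zmod_iso U V -> zmod_iso V U.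
Proof.
move=> [f [h fK hK]]; have hB : zmod_morphism h.
  by move=> x y; apply: (can_inj fK); rewrite raddfB !hK.
by exists (additive_of hB); exists f.
Qed.

(** Neither end of a zigzag determines the other, so the isomorphism is extracted from an additive
    correspondence. The last condition makes it single valued on classes and injective at once. *)
Lemma relation_iso (X T : zmodType) (B : zmodClosed X) (rho : X -> T -> Prop) :
    (forall x x' y y', rho x y -> rho x' y' -> rho (x - x') (y - y')) ->
    (forall x, exists y, rho x y) -> (forall y, exists x, rho x y) ->
    (forall x y, rho x y -> x \in B <-> y = 0) ->
  zmod_iso (Quotient.quot B) T.
Proof.
move=> rhoB /choice[f fP] rho_surj rho0.
pose h (q : Quotient.quot B) := f (repr q).
have hP x y : rho x y -> h (\pi x) = y.
  move=> xy; apply/eqP; rewrite -subr_eq0; apply/eqP.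
  apply: (rho0 _ _ (rhoB _ _ _ _ (fP _) xy)).1.
  by rewrite -quot_eq0 raddfB /= reprK subrr.
have hB : zmod_morphism h.
  move=> q r; rewrite -(reprK q) -(reprK r) -raddfB.
  by rewrite (hP _ _ (rhoB _ _ _ _ (fP _) (fP _))) !(hP _ _ (fP _)).
exists (additive_of hB); apply: inj_surj_bijective => /= [q r qr|y].
  apply/eqP; rewrite -subr_eq0 -(reprK q) -(reprK r) -raddfB quot_eq0.
  apply/(rho0 _ _ (rhoB _ _ _ _ (fP _) (fP _))).
  by rewrite -[f (repr q)]/(h q) qr subrr.
by have [x xy] := rho_surj y; exists (\pi x); apply: hP.
Qed.

Section ResolvedHomology.
Variable G : groupType.
Hypothesis mulgC : forall x y : G, (x * y = y * x)%g.

Local Notation row n := 'rV[gring G]_n.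
Local Notation aug_mx := (map_mx (@aug G)).

Variables (M : lmodType (gring G)) (N : nat -> nat).
Variable D : forall k, 'M[gring G]_(N k.+1, N k).
Variable e : {linear row (N 0) -> M}.
Hypothesis D_exact : exact_seq D.
Hypothesis e_surj : forall m, exists x, e x = m.
Hypothesis e_ker : forall x, e x = 0 <-> exists y, x = y *m D 0.

Lemma bdry_coefmap_linear k (c : chain (row (N 0)) k.+1) :
  bdry (coefmap e c) = coefmap e (bdry c).
Proof. by apply: bdry_coefmap => h v; apply: linearZ_LR. Qed.

Lemma coefmap_linear_eq0 k (c : chain (row (N 0)) k) :
  coefmap e c = 0 <-> exists c' : chain (row (N 1)) k, c = coefmap (row_map (D 0)) c'.
Proof.
split=> [c0|[c' ->]].
  have [t|c' <-] := @coefmap_lift _ _ (row_map (D 0)) _ c; last by exists c'.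
  by have /e_ker[y ->] := coefmap_ker t c0; exists y.
apply/malgP => t; rewrite !coefmap_coef mcoeff0 /=.
by apply/e_ker; exists (c'@_t).
Qed.

Lemma coefmap_linear_lift k (c : chain M k) : exists c', coefmap e c' = c.
Proof. by apply: coefmap_lift => t; apply: e_surj. Qed.

Definition resolution_cycle k (y : 'rV[int]_(N k)) : Prop :=
  match k return 'rV[int]_(N k) -> Prop with
  | 0 => fun=> True
  | k'.+1 => fun y => y *m aug_mx (D k') = 0
  end y.

(** The homology of the coinvariants enters through [q], which is onto on cycles with the boundaries
    as kernel there; this spares the construction of a subquotient of row vectors. *)
Theorem resolution_homology k (T : zmodType) (q : {additive 'rV[int]_(N k) -> T}) :
    (forall y, exists2 x, resolution_cycle x & q x = y) ->
    (forall x, resolution_cycle x -> q x = 0 <-> exists w, x = w *m aug_mx (D k)) ->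
  zmod_iso (homology M k) T.
Proof.
move=> q_surj q_ker.
(* A cycle over [M] is lifted to the free module in degree 0 and followed along a zigzag. Both are
   choices, and [rel] keeps all of them. *)
pose rel (z : cycles M k) (x : row (N k)) :=
  exists2 c : chain (row (N 0)) k, coefmap e c = val z & zigzag D c x.
have aug_lift n (y : 'rV[int]_n) : exists x : row n, aug_mx x = y.
  exists (map_mx (intr : int -> gring G) y); apply/matrixP => i j.
  by rewrite !mxE rmorph_int intz.
have relB z z' x x' : rel z x -> rel z' x' -> rel (z - z') (x - x').
  move=> [c cz cx] [c' cz' cx']; exists (c - c'); last exact: zigzagB.
  by rewrite raddfB /= cz cz'.
have rel_cycle z x : rel z x -> resolution_cycle (aug_mx x).
  case: (k) @rel z x {relB q q_surj q_ker} => //= p z x [c _ cx].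
  by rewrite -map_mxM; apply: zigzag_cycle cx.
have rel_total z : exists x, rel z x.
  case: (k) @rel z {relB q q_surj q_ker rel_cycle} => [|p] /= [z /= zP].
    have [c cz] := coefmap_linear_lift z.
    by exists c@_(no_letter G), c => //; apply: chain0E.
  have [c cz] := coefmap_linear_lift z.
  have [|x cx] := zigzag_total mulgC D_exact (c := c); last by exists x, c.
  by apply/coefmap_linear_eq0; rewrite -bdry_coefmap_linear cz; apply/eqP.
have rel_surj x : resolution_cycle (aug_mx x) -> exists z, rel z x.
  case: (k) @rel x {relB q q_surj q_ker rel_cycle rel_total} => [|p] /= x xD.
    by exists (@Cycle _ _ 0 (coefmap e << x *g no_letter G >>) isT), << x *g no_letter G >>.
  have [|c cx] := zigzag_lift D_exact (x := x); first by rewrite map_mxM.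
  have cP : @Defs.cycle _ M p.+1 (coefmap e c).
    rewrite /= bdry_coefmap_linear; apply/eqP/coefmap_linear_eq0.
    by have [c' cc' _] := cx; exists c'.
  by exists (Cycle cP), c.
have rel_boundary z x : rel z x -> z \in @boundary _ M k <-> q (aug_mx x) = 0.
  move=> zx; have xP := rel_cycle _ _ zx; have [c cz cx] := zx.
  apply: iff_trans (iff_sym (q_ker _ xP)); split=> [/asboolP[w wz]|[w xw]].
    have [b bw] := coefmap_linear_lift w.
    have /coefmap_linear_eq0[b' cE] : coefmap e (c - bdry b) = 0.
      by rewrite raddfB /= -bdry_coefmap_linear bw cz wz subrr.
    have [|w' xw'] := zigzag_bdry mulgC D_exact (b := b) (b' := b') cx.
      by rewrite -cE addrC subrK.
    by exists (aug_mx w'); rewrite xw' map_mxM.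
  have [w' w'w] := aug_lift _ w; apply/asboolP.
  have [|b [b' cE]] := bdry_zigzag D_exact (w := w') cx; first by rewrite map_mxM w'w.
  exists (coefmap e b); rewrite bdry_coefmap_linear -cz cE raddfD /=.
  by rewrite [X in _ + X](coefmap_linear_eq0 _).2 ?addr0 //; exists b'.
apply: (@relation_iso _ _ _ (fun z y => exists2 x, rel z x & q (aug_mx x) = y)).
- move=> z z' y y' [x zx <-] [x' zx' <-]; exists (x - x'); first exact: relB.
  by rewrite map_mxB raddfB.
- by move=> z; have [x zx] := rel_total z; exists (q (aug_mx x)), x.
- move=> y; have [x' x'P <-] := q_surj y; have [x xx'] := aug_lift _ x'.
  by have [|z zx] := rel_surj x; [rewrite xx' | exists z, x; rewrite ?xx'].
by move=> z y [x zx <-]; apply: rel_boundary.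
Qed.
End ResolvedHomology.

Lemma free_module_homology (G : groupType) (M : lmodType (gring G)) k :
  free_module M -> forall x : homology M k.+1, x = 0.
Proof.
move=> /free_module_coord[I [b [coord [coordZ coordK]]]] x.
rewrite -(reprK x); apply/eqP; rewrite quot_eq0; case: (repr x) => z zP.
by apply/asboolP; have [c zE] := free_exact coordZ coordK (eqP zP); exists c.
Qed.

(** * The Koszul complex *)

(* kdim m n = 'C(n, m), with equations that hold by conversion. *)
Fixpoint kdim m : nat -> nat :=
  match m with
  | 0 => fun=> 1
  | m'.+1 => fix kdim_m n := match n with
                             | 0 => 0
                             | n'.+1 => kdim_m n' + kdim m' n'
                             end
  end%N.

Lemma kdimE m n : kdim m n = 'C(n, m).
Proof.
elim: m n => [|m IHm] n; first by rewrite bin0.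
by elim: n => [//|n IHn]; rewrite binS -IHn -IHm.
Qed.

Lemma ltn_kdim1 n (u : 'I_(kdim 1 n)) : (u < n)%N.
Proof. by rewrite -[X in (_ < X)%N](bin1 n) -kdimE; apply: ltn_ord. Qed.

Section Koszul.
Variables (R : comNzRingType) (t : nat -> R).

(* In degree m, the Koszul complex on t_0 - 1, ..., t_n - 1 is
   K_m (+) e_n K_(m-1), for K the Koszul complex on t_0 - 1, ..., t_(n-1) - 1. *)
Fixpoint koszul m : forall n, 'M[R]_(kdim m.+1 n, kdim m n) :=
  match m with
  | 0 => fix koszul_m n : 'M[R]_(kdim 1 n, kdim 0 n) :=
      match n with
      | 0 => 0
      | n'.+1 => col_mx (koszul_m n') (t n' - 1)%:M
      end
  | m'.+1 => fix koszul_m n : 'M[R]_(kdim m'.+2 n, kdim m'.+1 n) :=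
      match n with
      | 0 => 0
      | n'.+1 => block_mx (koszul_m n') 0 (t n' - 1)%:M (- koszul m' n')
      end
  end.

Definition koszul_pair m n (a : 'rV[R]_(kdim m.+1 n)) (b : 'rV[R]_(kdim m n)) :
  'rV[R]_(kdim m.+1 n.+1) := row_mx a b.

Lemma koszul_pairE m n (x : 'rV[R]_(kdim m.+1 n.+1)) : exists a b, x = koszul_pair a b.
Proof.
exists (@lsubmx _ _ (kdim m.+1 n) (kdim m n) x), (@rsubmx _ _ (kdim m.+1 n) (kdim m n) x).
by rewrite /koszul_pair hsubmxK.
Qed.

Lemma koszul_pair_inj m n (a a' : 'rV[R]_(kdim m.+1 n)) (b b' : 'rV[R]_(kdim m n)) :
  koszul_pair a b = koszul_pair a' b' -> a = a' /\ b = b'.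
Proof. exact: eq_row_mx. Qed.

Lemma koszul_pair0 m n : koszul_pair 0 0 = 0 :> 'rV[R]_(kdim m.+1 n.+1).
Proof. exact: row_mx0. Qed.

Lemma koszul_pairD m n (a a' : 'rV[R]_(kdim m.+1 n)) (b b' : 'rV[R]_(kdim m n)) :
  koszul_pair a b + koszul_pair a' b' = koszul_pair (a + a') (b + b').
Proof. exact: add_row_mx. Qed.

Lemma koszul_pairZ m n c (a : 'rV[R]_(kdim m.+1 n)) (b : 'rV[R]_(kdim m n)) :
  c *: koszul_pair a b = koszul_pair (c *: a) (c *: b).
Proof. exact: scale_row_mx. Qed.

Lemma koszul_pairM0 n (a : 'rV[R]_(kdim 1 n)) (b : 'rV[R]_(kdim 0 n)) :
  koszul_pair a b *m koszul 0 n.+1 = a *m koszul 0 n + (t n - 1) *: b.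
Proof.
rewrite -mul_mx_scalar.
exact: (@mul_row_col _ 1 (kdim 1 n) (kdim 0 n) (kdim 0 n)).
Qed.

Lemma koszul_pairMS m n (a : 'rV[R]_(kdim m.+2 n)) (b : 'rV[R]_(kdim m.+1 n)) :
  koszul_pair a b *m koszul m.+1 n.+1 =
  koszul_pair (a *m koszul m.+1 n + (t n - 1) *: b) (- (b *m koszul m n)).
Proof.
have := @mul_row_block _ 1 (kdim m.+2 n) (kdim m.+1 n) (kdim m.+1 n) (kdim m n) a b
  (koszul m.+1 n) 0 (t n - 1)%:M (- koszul m n).
by rewrite mulmx0 add0r mulmxN mul_mx_scalar.
Qed.

Lemma koszul_koszul_row m n (x : 'rV[R]_(kdim m.+2 n)) :
  x *m koszul m.+1 n *m koszul m n = 0.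
Proof.
elim: n m x => [|n IHn] m x.
  by rewrite (_ : x = 0) ?mul0mx //; apply/matrixP => i [].
have [a [b ->]] := koszul_pairE x; rewrite koszul_pairMS.
case: m x a b => [|m] x a b.
  by rewrite koszul_pairM0 mulmxDl IHn add0r -scalemxAl scalerN subrr.
rewrite koszul_pairMS mulmxDl IHn add0r mulNmx IHn oppr0 -scalemxAl scalerN subrr.
by rewrite oppr0 koszul_pair0.
Qed.

Lemma koszul_koszul m n : koszul m.+1 n *m koszul m n = 0.
Proof.
by apply/row_matrixP => i; rewrite row0 row_mul rowE koszul_koszul_row.
Qed.

Variable N : nat.
(** Regularity of the sequence t_n - 1: the row space of [koszul 0 n] is the ideal generated by the
    earlier t_i - 1. *)
Hypothesis t_regular : forall n (b : 'rV[R]_(kdim 0 n)), (n < N)%N ->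
  (exists x, (t n - 1) *: b = x *m koszul 0 n) -> exists y, b = y *m koszul 0 n.

(** Adding a variable takes the mapping cone of multiplication by t_n - 1, which stays exact because
    that map is injective on the degree 0 homology of the smaller complex. *)
Lemma koszul_exact m n (x : 'rV[R]_(kdim m.+1 n)) : (n <= N)%N ->
  x *m koszul m n = 0 -> exists y, x = y *m koszul m.+1 n.
Proof.
elim: n m x => [|n IHn] m x ltnN xD; first by exists 0; apply/matrixP => i [].
have lenN := ltnW ltnN.
have [a [b xE]] := koszul_pairE x.
(* In degree 0 this is regularity; above it, the second component of the differential shows that b
   is a cycle of the smaller complex. *)
have [b' bE] : exists b', b = b' *m koszul m n.
  case: m x xD a b xE => [|m] x xD a b xE.
    apply: t_regular => //; exists (- a); rewrite mulNmx; apply/eqP.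
    by rewrite -addr_eq0 addrC -koszul_pairM0 -xE xD.
  apply: IHn => //; move: xD; rewrite xE koszul_pairMS -koszul_pair0.
  by case/koszul_pair_inj => _ /eqP; rewrite oppr_eq0 => /eqP.
have [a' aE] : exists a', a + (t n - 1) *: b' = a' *m koszul m.+1 n.
  apply: IHn; rewrite // mulmxDl -scalemxAl -bE.
  case: m x xD a b xE b' bE => [|m] x xD a b xE b' bE.
    by rewrite -koszul_pairM0 -xE xD.
  by move: xD; rewrite xE koszul_pairMS -koszul_pair0 => /koszul_pair_inj[].
(* The sign of b' offsets the minus sign in the lower right block of the differential. *)
exists (koszul_pair a' (- b')); rewrite koszul_pairMS -aE mulNmx opprK -bE.
by rewrite scalerN addrK.
Qed.

Lemma koszul0_entry n u : koszul 0 n u ord0 = t u - 1.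
Proof.
elim: n u => [|n IHn] u; first by case: u.
rewrite -[koszul 0 n.+1]/(@col_mx _ (kdim 1 n) (kdim 0 n) (kdim 0 n) (koszul 0 n) (t n - 1)%:M).
rewrite mxE; case: splitP => j -> //.
by rewrite mxE (ord1 j) eqxx mulr1n kdimE bin1 addn0.
Qed.

(** Every nonzero entry is some t_k - 1 up to sign. *)
Lemma koszul_const_mx (S : pzRingType) (f : {rmorphism R -> S}) m n :
  (forall k, f (t k) = 1) -> map_mx f (koszul m n) = 0.
Proof.
move=> ft; have ft0 k p : map_mx f ((t k - 1)%:M : 'M_p) = 0.
  by rewrite map_scalar_mx rmorphB rmorph1 ft subrr raddf0.
elim: n m => [|n IHn] [|m]; rewrite ?map_mx0 //.
  apply: etrans (@map_col_mx _ _ f (kdim 1 n) (kdim 0 n) (kdim 0 n) _ _) _.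
  by rewrite IHn ft0 col_mx0.
apply: etrans (@map_block_mx _ _ f (kdim m.+2 n) (kdim m.+1 n) (kdim m.+1 n)
  (kdim m n) _ _ _ _) _.
by rewrite map_mxN !IHn ft0 map_mx0 oppr0 block_mx_const.
Qed.
End Koszul.

(** * The group ring of the lattice *)

Section LatticeVectors.
Variable g : nat.
Local Notation V := 'rV[int]_(2 * g).

Definition unit_row (k : nat) : V := \row_j (j == k :> nat)%:R.

(** On group elements this is the substitution t_i = 1 for i < k. *)
Definition trunc (k : nat) (v : V) : V := \row_j (if (j < k)%N then 0 else v ord0 j).

Lemma truncD k u v : trunc k (u + v) = trunc k u + trunc k v.
Proof. by apply/rowP => j; rewrite !mxE; case: ifP; rewrite ?addr0. Qed.

Lemma trunc_unit_row_ge k i : (k <= i)%N -> trunc k (unit_row i) = unit_row i.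
Proof.
move=> ki; apply/rowP => j; rewrite !mxE; case: ltnP => // jk.
by rewrite ltn_eqF // (leq_trans jk).
Qed.

Lemma trunc_unit_row_lt k i : (i < k)%N -> trunc k (unit_row i) = 0.
Proof.
move=> ki; apply/rowP => j; rewrite !mxE; case: ltnP => // jk.
by rewrite gtn_eqF // (leq_trans ki).
Qed.


Variables (R : comNzRingType) (T : V -> R).
Hypothesis TD : forall u v, T (u + v) = T u * T v.
Hypothesis T0 : T 0 = 1.
Variable k : nat.

Definition in_ideal (a : R) := exists x, a%:M = x *m koszul (fun i => T (unit_row i)) 0 k.

Lemma in_ideal0 : in_ideal 0.
Proof. by exists 0; rewrite mul0mx raddf0. Qed.

Lemma in_idealB a b : in_ideal a -> in_ideal b -> in_ideal (a - b).
Proof. by move=> [x xa] [y yb]; exists (x - y); rewrite mulmxBl -xa -yb raddfB. Qed.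

Lemma in_idealD a b : in_ideal a -> in_ideal b -> in_ideal (a + b).
Proof. by move=> [x xa] [y yb]; exists (x + y); rewrite mulmxDl -xa -yb raddfD. Qed.

Lemma in_idealM c a : in_ideal a -> in_ideal (c * a).
Proof. by move=> [x xa]; exists (c *: x); rewrite -scalemxAl -xa scale_scalar_mx. Qed.

Lemma in_ideal_T_unit i : (i < k)%N -> in_ideal (T (unit_row i) - 1).
Proof.
move=> ik; have ik' : (i < kdim 1 k)%N by rewrite kdimE bin1.
exists (delta_mx ord0 (Ordinal ik')); rewrite -rowE.
apply/rowP => j; rewrite [RHS]mxE !ord1 koszul0_entry mxE eqxx mulr1n.
by [].
Qed.

Lemma in_ideal_T_sub u v : in_ideal (T u - 1) -> in_ideal (T v - 1) ->
  in_ideal (T (u - v) - 1).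
Proof.
move=> Qu Qv; have -> : T (u - v) - 1 = T (- v) * ((T u - 1) - (T v - 1)).
  have e1 : T (- v) * T u = T (u - v) by rewrite -[LHS]TD addrC.
  have e2 : T (- v) * T v = 1 by rewrite -[LHS]TD addNr T0.
  by rewrite opprB addrA addrNK mulrBr e1 e2.
exact/in_idealM/in_idealB.
Qed.

Lemma in_ideal_T0 : in_ideal (T 0 - 1).
Proof. by rewrite T0 subrr; apply: in_ideal0. Qed.

Lemma in_ideal_T_add u v : in_ideal (T u - 1) -> in_ideal (T v - 1) ->
  in_ideal (T (u + v) - 1).
Proof.
move=> Qu Qv; rewrite -[v]opprK -[- v]sub0r.
by do 2![apply: in_ideal_T_sub => //]; apply: in_ideal_T0.
Qed.

Lemma in_ideal_T_mulz v z : in_ideal (T v - 1) -> in_ideal (T (v *~ z) - 1).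
Proof.
move=> Qv; have Qn n : in_ideal (T (v *+ n) - 1).
  elim: n => [|n IHn]; first exact: in_ideal_T0.
  by rewrite mulrS; apply: in_ideal_T_add.
case: z => n; first exact: Qn.
rewrite NegzE mulrNz -sub0r; apply: in_ideal_T_sub; [exact: in_ideal_T0 | exact: Qn].
Qed.

(** The vectors v with T v - 1 in the ideal form a subgroup. It contains the first k basis vectors,
    hence h - [trunc k h]. *)
Lemma in_ideal_T_trunc h : in_ideal (T h - T (trunc k h)).
Proof.
have -> : T h - T (trunc k h) = T (trunc k h) * (T (h - trunc k h) - 1).
  have e : T (trunc k h) * T (h - trunc k h) = T h by rewrite -[LHS]TD addrC subrK.
  by rewrite mulrBr mulr1 e.
apply: in_idealM.
have -> : h - trunc k h =
    \sum_(j < 2 * g) unit_row j *~ (if (j < k)%N then h ord0 j else 0).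
  apply/rowP => j; rewrite !mxE summxE (bigD1 j) //= big1 ?addr0.
    rewrite -scaler_int !mxE eqxx mulr1 intz.
    by case: ifP; rewrite ?subr0 ?subrr.
  move=> i ij; rewrite -scaler_int !mxE [_ == _ :> nat](_ : _ = false) ?mulr0 //.
  by apply/negbTE; rewrite eq_sym.
elim/big_ind: _ => [|u v|j _]; [exact: in_ideal_T0 | exact: in_ideal_T_add |].
case: (ltnP j k) => jk; first exact/in_ideal_T_mulz/in_ideal_T_unit.
by rewrite mulr0z; apply: in_ideal_T0.
Qed.

End LatticeVectors.

Section Lattice.
Variable g : nat.
Local Notation V := 'rV[int]_(2 * g).
Local Notation H := (H1_lattice g).
Local Notation L := (gring H).

Lemma lattice_mulE (x y : H) : (x * y)%g = (x : V) + y.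
Proof. by []. Qed.

Lemma lattice_mulgC (x y : H) : (x * y = y * x)%g.
Proof. by rewrite !lattice_mulE addrC. Qed.

Fact lattice_gr_mulC : commutative (@GRing.mul L).
Proof.
move=> a b; elim/(@gr_ind H): a => [|a1 a2 IH1 IH2|n x].
- by rewrite mul0r mulr0.
- by rewrite mulrDl mulrDr IH1 IH2.
elim/(@gr_ind H): b => [|b1 b2 IH1 IH2|m y].
- by rewrite mul0r mulr0.
- by rewrite mulrDl mulrDr IH1 IH2.
by rewrite [LHS]gr_mulUU [RHS]gr_mulUU lattice_mulgC mulrC.
Qed.

HB.instance Definition _ := GRing.PzRing_hasCommutativeMul.Build L lattice_gr_mulC.

(* Locked: unification would otherwise unfold products in the group ring. *)
Fact lattice_gelt_key : unit. Proof. by []. Qed.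
Definition lattice_gelt (v : V) : L := locked_with lattice_gelt_key (gelt (v : H)).
Local Notation T := lattice_gelt.

Lemma lattice_geltE v : T v = gelt (v : H).
Proof. by rewrite /T unlock. Qed.

Lemma lattice_geltD u v : T (u + v) = T u * T v.
Proof. by rewrite !lattice_geltE -geltM. Qed.

Lemma lattice_gelt0 : T 0 = 1.
Proof. by rewrite lattice_geltE. Qed.

Local Notation unit_row := (unit_row g).

Definition tvar (k : nat) : L := T (unit_row k).

Local Notation in_ideal k := (in_ideal T k).

Lemma augT v : aug (T v) = 1.
Proof. by rewrite lattice_geltE augU. Qed.

Fact truncT_is_additive k h : zmod_morphism (fun n : int => T (trunc k h) *~ n).
Proof. by move=> x y; rewrite mulrzBr. Qed.

Definition specialize k : L -> L :=
  malg_ext (fun h : H => additive_of (truncT_is_additive k h)).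

HB.instance Definition _ k := GRing.Additive.copy (specialize k)
  (malg_ext (fun h : H => additive_of (truncT_is_additive k h))).

Lemma specializeT k h : specialize k (T h) = T (trunc k h).
Proof. by rewrite [in LHS]lattice_geltE [LHS]malg_extU /= mulr1z. Qed.

Lemma lattice_additive_eq (W : zmodType) (f f' : {additive L -> W}) :
  (forall h, f (T h) = f' (T h)) -> f =1 f'.
Proof.
move=> ff' a; rewrite (gr_generated a) !raddf_sum.
by apply: eq_bigr => h _; rewrite !raddfMz /= -lattice_geltE ff'.
Qed.

Lemma specializeM k v a : specialize k (T v * a) = T (trunc k v) * specialize k a.
Proof.
suff: specialize k \o (T v \*o idfun) =1 T (trunc k v) \*o specialize k by apply.
apply: lattice_additive_eq => h /=.
by rewrite [X in _ = _ * X]specializeT -[X in specialize k X]lattice_geltD specializeT truncD [LHS]lattice_geltD.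
Qed.

Lemma gr_coefM v a h : (T v * a)@_h = a@_((h : V) - v : H).
Proof.
pose f := (@mcoeff H int h : {additive L -> int}) \o (T v \*o idfun).
suff: f =1 (@mcoeff H int ((h : V) - v) : {additive L -> int}) by apply.
apply: lattice_additive_eq => u.
rewrite /f /= -[X in X@__]lattice_geltD !lattice_geltE /gelt !mcoeffU; congr (_ *+ nat_of_bool _).
by rewrite [in RHS]eq_sym subr_eq eq_sym addrC.
Qed.

(** An element fixed by t_k has a support stable under translation, which is finite only when
    empty. *)
Lemma tvar_nonzerodiv k a : (k < 2 * g)%N -> (tvar k - 1) * a = 0 -> a = 0.
Proof.
move=> kn; rewrite mulrBl mul1r => /eqP; rewrite subr_eq0 => /eqP aE.
apply/eqP/negP => /negP a0.
have [h ha] : exists h, h \in msupp a.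
  case: (fset_0Vmem (msupp a)) => [sa0|[h ha]]; last by exists h.
  by case/eqP: a0; apply/malgP => h; rewrite mcoeff0 mcoeff_outdom ?sa0.
(* One more translate of h than the support has room for. *)
pose s := [seq ((h : V) - unit_row k *+ i : H) | i <- iota 0 (size (msupp a)).+1].
have s_uniq : uniq s.
  rewrite map_inj_uniq ?iota_uniq // => i j /addrI /oppr_inj /rowP/(_ (Ordinal kn)).
  by rewrite !mulmxnE !mxE eqxx => /eqP; rewrite eqr_nat => /eqP.
have s_sub : {subset s <= msupp a}.
  move=> _ /mapP[i _ ->]; elim: i => [|i IHi]; first by rewrite mulr0n subr0.
  by rewrite -mcoeff_neq0 mulrSr opprD addrA -gr_coefM aE mcoeff_neq0.
by have := uniq_leq_size s_uniq s_sub; rewrite size_map size_iota ltnn.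
Qed.

Section Specialize.
Variable k : nat.

(** With [specialize_ideal], this presents the ideal as the kernel of an idempotent substitution, so
    that working modulo the ideal becomes working with elements of L. *)
Lemma in_ideal_specialize a : in_ideal k (a - specialize k a).
Proof.
elim/(@gr_ind H): a => [|a b Ja Jb|n h]; first by rewrite raddf0 subr0; apply: in_ideal0.
  by rewrite raddfD opprD addrACA; apply: in_idealD.
have hE : << n *g h >> = T h *~ n :> L.
  by rewrite lattice_geltE /gelt -(raddfMz (@mkmalgU H int h)) intz.
have -> : specialize k << n *g h >> = T (trunc k h) *~ n.
  by rewrite -specializeT -(raddfMz (specialize k)) -hE.
rewrite hE.
rewrite -mulrzBl -mulrzl; apply: in_idealM.
exact: (in_ideal_T_trunc lattice_geltD lattice_gelt0).
Qed.

Lemma specialize_ideal a : in_ideal k a -> specialize k a = 0.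
Proof.
move=> [x /matrixP/(_ ord0 ord0)]; rewrite !mxE eqxx mulr1n => ->.
rewrite raddf_sum big1 //= => u _; rewrite koszul0_entry mulrBr mulr1 mulrC.
rewrite raddfB /= specializeM trunc_unit_row_lt ?lattice_gelt0 ?mul1r ?subrr //.
exact: ltn_kdim1.
Qed.
End Specialize.

(** The substitution fixes t_k, so t_k - 1 times the specialized element vanishes, and
    [tvar_nonzerodiv] applies inside L itself. *)
Lemma tvar_regular k (b : 'rV[L]_(kdim 0 k)) : (k < 2 * g)%N ->
    (exists x, (tvar k - 1) *: b = x *m koszul tvar 0 k) ->
  exists y, b = y *m koszul tvar 0 k.
Proof.
move=> kn; have [a ->] : exists a, b = a%:M by exists (b ord0 ord0); apply: mx11_scalar.
rewrite scale_scalar_mx => /specialize_ideal.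
rewrite mulrBl mul1r raddfB /= specializeM trunc_unit_row_ge // -[X in _ - X]mul1r -mulrBl.
move/(tvar_nonzerodiv kn) => a0.
by have := in_ideal_specialize k a; rewrite a0 subr0.
Qed.
End Lattice.

(** * Fox calculus *)

Section Fox.
Variable g : nat.
Local Notation V := 'rV[int]_(2 * g).
Local Notation unit_row := (unit_row g).
Variables (R : comNzRingType) (T : V -> R).
Hypothesis TD : forall u v, T (u + v) = T u * T v.
Hypothesis T0 : T 0 = 1.

Local Notation N := (kdim 1 g.*2).
Local Notation t := (fun k => T (unit_row k)).
Implicit Types w : word 'I_(2 * g).

Definition basis_row n (k : nat) : 'rV[R]_(kdim 1 n) := \row_u (u == k :> nat)%:R.

Definition exponents w : V :=
  \sum_(l <- w) (if l.2 then unit_row l.1 else - unit_row l.1).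

Definition fox_letter (l : 'I_(2 * g) * bool) : 'rV[R]_N :=
  if l.2 then basis_row g.*2 l.1
  else - (T (- unit_row l.1) *: basis_row g.*2 l.1).

(** The entries are the Fox derivatives of w with coefficients already abelianized; the product rule
    D(vw) = D v + v D w is [fox_cat]. *)
Fixpoint fox w : 'rV[R]_N :=
  if w is l :: w' then fox_letter l + T (exponents [:: l]) *: fox w' else 0.

Lemma exponents_cat v w : exponents (v ++ w) = exponents v + exponents w.
Proof. exact: big_cat. Qed.

Lemma exponents1 l :
  exponents [:: l] = if l.2 then unit_row l.1 else - unit_row l.1.
Proof. exact: big_seq1. Qed.

Lemma fox1 l : fox [:: l] = fox_letter l.
Proof. by rewrite /= scaler0 addr0. Qed.

Lemma fox_cat v w : fox (v ++ w) = fox v + T (exponents v) *: fox w.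
Proof.
elim: v => [|l v IHv] /=; first by rewrite /exponents big_nil T0 scale1r add0r.
by rewrite IHv scalerDr scalerA -TD addrA -exponents_cat.
Qed.

Lemma fox_inv w : fox (word_inv w) = - (T (- exponents w) *: fox w).
Proof.
elim: w => [|l w IHw]; first by rewrite /word_inv /= scaler0 oppr0.
have -> : word_inv (l :: w) = word_inv w ++ [:: (l.1, ~~ l.2)].
  by rewrite /word_inv /= rev_cons cats1.
have exponents_inv v : exponents (word_inv v) = - exponents v.
  rewrite /exponents /word_inv (perm_big _ (permEl (perm_rev _))) big_map -sumrN.
  by apply: eq_bigr => -[i []] _; rewrite ?opprK.
have letter_inv : fox_letter (l.1, ~~ l.2) =
    - (T (- exponents [:: l]) *: fox_letter l).
  rewrite exponents1 /fox_letter; case: l => i [] //=.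
  by rewrite scalerN !opprK scalerA -TD subrr T0 scale1r.
rewrite fox_cat IHw fox1 exponents_inv letter_inv -[l :: w]cat1s exponents_cat.
rewrite fox_cat fox1 opprD TD scalerN scalerDr !scalerA opprD addrC.
have e : T (- exponents [:: l]) * T (exponents [:: l]) = 1 by rewrite -TD addNr T0.
by rewrite [_ * _ * _]mulrAC e mul1r [X in - (X *: fox_letter l)]mulrC.
Qed.

Lemma fox_cancel x b : fox [:: (x, b); (x, ~~ b)] = 0.
Proof.
rewrite /= scaler0 addr0 exponents1 /fox_letter; case: b => /=.
  by rewrite scalerN scalerA -TD subrr T0 scale1r subrr.
by rewrite addNr.
Qed.

Lemma basis_row_koszul n k : (k < n)%N -> basis_row n k *m koszul t 0 n = (t k - 1)%:M.
Proof.
move=> kn; have kn' : (k < kdim 1 n)%N by rewrite kdimE bin1.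
have -> : basis_row n k = delta_mx ord0 (Ordinal kn').
  by apply/rowP => j; rewrite !mxE eqxx.
rewrite -rowE; apply/rowP => j.
by rewrite [LHS]mxE !ord1 koszul0_entry mxE eqxx mulr1n.
Qed.

(** The fundamental formula of Fox calculus. It places the derivative of a word of exponent zero in
    Z_1. *)
Lemma fox_koszul w : fox w *m koszul t 0 g.*2 = (T (exponents w) - 1)%:M.
Proof.
have lt_2g (i : 'I_(2 * g)) : (i < g.*2)%N by rewrite -mul2n.
elim: w => [|[i b] w IHw].
  by rewrite /exponents big_nil T0 subrr raddf0 [fox _]/= mul0mx.
rewrite -cat1s fox_cat fox1 mulmxDl -scalemxAl IHw exponents_cat TD exponents1.
rewrite scale_scalar_mx /fox_letter; case: b; rewrite [(_, _).1]/= [(_, _).2]/=.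
  by rewrite basis_row_koszul // -raddfD /=; congr (_%:M); ring.
rewrite mulNmx -scalemxAl basis_row_koszul // scale_scalar_mx -raddfN -raddfD.
congr (_%:M); have e : T (- unit_row i) * t i = 1 by rewrite -TD addNr T0.
by rewrite -[X in _ = _ - X]e; ring.
Qed.

Lemma scaleTA n h h' (x : 'rV[R]_n) : T h *: (T h' *: x) = T (h + h') *: x.
Proof. by rewrite scalerA -TD. Qed.

Lemma scale_fox_cons h l w :
  T h *: fox (l :: w) = T h *: fox_letter l + T (h + exponents [:: l]) *: fox w.
Proof. by rewrite /= scalerDr scalerA -TD. Qed.

Lemma scale_fox_letter_inv h i :
  T h *: fox_letter (i, false) = - (T (h - unit_row i) *: basis_row g.*2 i).
Proof. by rewrite /fox_letter /= scalerN scalerA -TD. Qed.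

Lemma scale_basis_row_koszul h (i : 'I_(2 * g)) :
  T h *: basis_row g.*2 i *m koszul t 0 g.*2 = (T (h + unit_row i) - T h)%:M.
Proof.
rewrite -scalemxAl basis_row_koszul -?mul2n // scale_scalar_mx.
by rewrite mulrBr mulr1 -TD.
Qed.

(** The word v x_i u^-1 is a Schreier generator when v and u represent the section at the two ends
    of an edge; the derivative recovers the edge up to terms of the section. *)
Lemma fox_transition v (i : 'I_(2 * g)) u : exponents u = exponents v + unit_row i ->
  fox (v ++ (i, true) :: word_inv u) =
  fox v + T (exponents v) *: basis_row g.*2 i - fox u.
Proof.
move=> uE; rewrite fox_cat scale_fox_cons exponents1 /= -uE fox_inv addrA.
by rewrite scalerN scalerA -TD subrr T0 scale1r.
Qed.

Lemma fox_comm (x y : 'I_(2 * g)) : fox (comm_word x y) =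
  T (- unit_row x - unit_row y) *:
    ((1 - t y) *: basis_row g.*2 x + (t x - 1) *: basis_row g.*2 y).
Proof.
rewrite /= scaler0 addr0 !exponents1 /fox_letter /=; apply/rowP => u; rewrite !mxE TD.
have ty : T (- unit_row y) * t y = 1 by rewrite -TD addNr T0.
move: (_ == _)%:R (_ == _)%:R (T (- unit_row x)) => ey ex X.
apply/eqP; rewrite -subr_eq0; apply/eqP.
(* The two sides agree only modulo the relation [ty], so their difference is displayed as a multiple
   of it. *)
transitivity ((T (- unit_row y) * t y - 1) * X * ex); first by ring.
by rewrite ty subrr !mul0r.
Qed.

Definition relator_coef (i : nat) : R := T (- unit_row i.*2 - unit_row i.*2.+1).

(* Entry at the generator k of the Fox derivative of the surface relator. *)
Definition relator_entry (k : nat) : R :=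
  if odd k then relator_coef k./2 * (t k.-1 - 1) else relator_coef k./2 * (1 - t k.+1).

(** Allowing any length n lets the row be built one generator at a time, in step with the recursion
    of the Koszul complex. *)
Definition relator_row n : 'rV[R]_(kdim 1 n) := \row_u relator_entry u.

Lemma exponents_comm (x y : 'I_(2 * g)) : exponents (comm_word x y) = 0.
Proof.
rewrite /exponents !big_cons big_nil /= addr0.
by rewrite addrA -opprD addNr.
Qed.

Lemma fox_relator : fox (surface_relator g) = relator_row g.*2.
Proof.
have fox_flatten (s : seq 'I_g) :
  fox (flatten [seq comm_word (pair_ord i false) (pair_ord i true) | i <- s]) =
  \sum_(i <- s) fox (comm_word (pair_ord i false) (pair_ord i true)).
  elim: s => [|i s IHs]; first by rewrite big_nil.
  by rewrite big_cons -IHs [LHS]fox_cat exponents_comm T0 scale1r.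
rewrite /surface_relator fox_flatten big_enum; apply/rowP => u.
have u2g : (u./2 < g)%N.
  by have := ltn_kdim1 u; rewrite -ltn_half_double.
rewrite summxE (bigD1 (Ordinal u2g)) // big1 ?addr0 => [|i iu]; last first.
  have {}iu : (i == u./2 :> nat) = false by apply/negbTE.
  rewrite fox_comm !mxE /= addn0 addn1.
  have -> : (u == i.*2 :> nat) = false.
    by apply/negbTE/eqP => ui; move: iu; rewrite ui doubleK eqxx.
  have -> : (u == i.*2.+1 :> nat) = false.
    by apply/negbTE/eqP => ui; move: iu; rewrite ui /= uphalf_double eqxx.
  by rewrite !mulr0 addr0 mulr0.
rewrite fox_comm !mxE /= addn0 addn1 /relator_entry -/(relator_coef _).
have := odd_double_half u; case: (odd u) => uE; rewrite (add0n, add1n) in uE.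
  have -> : (u == u./2.*2 :> nat) = false by rewrite -{1}uE gtn_eqF.
  have -> : u.-1 = u./2.*2 by rewrite -{1}uE.
  by rewrite uE eqxx mulr0 add0r mulr1 addr0.
have -> : (u == u./2.*2.+1 :> nat) = false by rewrite uE ltn_eqF.
by rewrite uE eqxx mulr0 !addr0 mulr1.
Qed.

(** The entry at generator 0 is a unit times 1 - t_1. *)
Lemma relator_row_regular n l :
  (0 < n)%N -> l *: relator_row n = 0 -> (t 1 - 1) * l = 0.
Proof.
move=> n0 l0; have n0' : (0 < kdim 1 n)%N by rewrite kdimE bin1.
have := congr1 (fun x : 'rV_(kdim 1 n) => x ord0 (Ordinal n0')) l0.
rewrite !mxE /relator_entry /= => lc0.
have c1 : T (unit_row 0 + unit_row 1) * relator_coef 0 = 1.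
  by rewrite /relator_coef double0 -opprD -TD subrr T0.
transitivity (- T (unit_row 0 + unit_row 1) * (l * (relator_coef 0 * (1 - t 1)))).
  transitivity (T (unit_row 0 + unit_row 1) * relator_coef 0 * ((t 1 - 1) * l)).
    by rewrite c1 mul1r.
  by ring.
by rewrite lc0 mulr0.
Qed.

(* The augmentation turns this chain into - omega. *)
Fixpoint relator_chain j : 'rV[R]_(kdim 2 j.*2) :=
  match j with
  | 0 => 0
  | j'.+1 => koszul_pair (koszul_pair (relator_chain j') 0)
               (@koszul_pair R 0 j'.*2 0 (- relator_coef j')%:M)
  end.

Lemma relator_rowS n :
  relator_row n.+1 = @koszul_pair R 0 n (relator_row n) (relator_entry n)%:M.
Proof.
apply/rowP => u; rewrite mxE /koszul_pair [RHS]mxE; case: splitP => j -> //.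
  by rewrite mxE.
by rewrite mxE ord1 eqxx mulr1n kdimE bin1 addn0.
Qed.

(** Each commutator bounds the square on its two generators: with c its unit and e_a, e_b at 2j and
    2j + 1, the boundary of - c e_b e_a is c (1 - t_b) e_a + c (t_a - 1) e_b, as in [fox_comm]. *)
Lemma relator_chain_koszul j : relator_chain j *m koszul t 1 j.*2 = relator_row j.*2.
Proof.
elim: j => [|j IHj]; first by apply/rowP => -[].
change (koszul_pair (koszul_pair (relator_chain j) 0)
    (@koszul_pair R 0 j.*2 0 (- relator_coef j)%:M) *m koszul t 1 j.*2.+2 =
  relator_row j.*2.+2).
rewrite !relator_rowS -IHj !koszul_pairMS koszul_pairM0 mul0mx scaler0 addr0 oppr0.
rewrite koszul_pairZ koszul_pairD scaler0 addr0 !add0r !scale_scalar_mx mulrN -raddfN.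
rewrite /relator_entry /= odd_double /= doubleK uphalf_double.
apply: (f_equal2 (@koszul_pair R 0 j.*2.+1)).
  by apply: (f_equal2 (@koszul_pair R 0 j.*2)) => //; congr (_%:M); ring.
by congr (_%:M); ring.
Qed.
(** Both claims go through one induction: comparing derivatives of concatenations requires that the
    prefixes have equal exponents. *)
Lemma pres_eq_fox v w :
    pres_eq (fun r : word 'I_(2 * g) => r = surface_relator g) v w ->
  exponents v = exponents w /\
  exists l : R, fox v - fox w = l *: fox (surface_relator g).
Proof.
elim=> {v w} [w|v w _ [vw [l vwE]]|u v w _ [uv [l uvE]] _ [vw [m vwE]]|
              v v' w w' _ [vv' [l vE]] _ [ww' [m wE]]|x b|r ->].
- by split=> //; exists 0; rewrite subrr scale0r.
- by split=> //; exists (- l); rewrite scaleNr -vwE opprB.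
- split; first by rewrite uv.
  by exists (l + m); rewrite scalerDl -uvE -vwE addrA subrK.
- split; first by rewrite !exponents_cat vv' ww'.
  exists (l + T (exponents v) * m); rewrite !fox_cat // scalerDl -scalerA -vE -wE vv'.
  by rewrite opprD addrACA scalerBr.
- split; first by case: b; rewrite /exponents !big_cons big_nil /= addr0 ?subrr ?addNr.
  by exists 0; rewrite fox_cancel // scale0r subr0.
- split; last by exists 1; rewrite scale1r subr0.
  rewrite /exponents big_nil /surface_relator.
  elim: (enum _) => [|i s IHs]; first by rewrite big_nil.
  by rewrite -[LHS]/(exponents (comm_word _ _ ++ _)) exponents_cat exponents_comm add0r.
Qed.

End Fox.

(** * The Reidemeister-Schreier map *)

Section DerivedClass.
Variable P : groupType.
Implicit Types x y : P.

Lemma derived_predE x : derived_pred x = (abel_pi x == 0).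
Proof.
have -> : x = (x / 1)%g by rewrite invg1 mulg1.
apply/abel_piP/eqP; first by rewrite invg1 mulg1.
by rewrite invg1 mulg1.
Qed.

Lemma abel_piV x : abel_pi (x^-1)%g = - abel_pi x.
Proof. by apply/eqP; rewrite -addr_eq0 -abel_piM mulVg. Qed.

(** A total function, with value 0 off the derived subgroup, so that classes of products can be
    written before membership is proved. *)
Definition derived_class x : abel (derived P) :=
  if insub x is Some d then abel_pi d else 0.

Lemma derived_classE (d : derived P) : derived_class (val d) = abel_pi d.
Proof. by rewrite /derived_class valK. Qed.

Lemma derived_classM x y : derived_pred x -> derived_pred y ->
  derived_class (x * y)%g = derived_class x + derived_class y.
Proof.
move=> Dx Dy; rewrite -[x]/(val (Derived Dx)) -[y]/(val (Derived Dy)) -gmulfM.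
by rewrite !derived_classE abel_piM.
Qed.

Lemma derived_class1 : derived_class 1%g = 0.
Proof. by rewrite -[1%g]/(val (1%g : derived P)) derived_classE. Qed.

Lemma derived_classV x : derived_pred x -> derived_class (x^-1)%g = - derived_class x.
Proof.
move=> Dx; apply/eqP; rewrite -addr_eq0 -derived_classM ?derivedV //.
by rewrite mulVg derived_class1.
Qed.

Lemma derived_classJ x y : derived_pred x ->
  derived_class (y * x * y^-1)%g = conj_act y (derived_class x).
Proof.
move=> Dx; rewrite -[x]/(val (Derived Dx)) derived_classE conj_actE -derived_classE.
by [].
Qed.
End DerivedClass.

Section Surface.
Variable g : nat.
Local Notation V := 'rV[int]_(2 * g).
Local Notation L := (gring (H1_lattice g)).
Local Notation P := (surface_group g).
Local Notation M := (surface_module g).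
Local Notation T := (@lattice_gelt g).
Local Notation unit_row := (unit_row g).
Local Notation N := (kdim 1 g.*2).
Local Notation fox := (fox T).
Implicit Types (w : word 'I_(2 * g)) (h : V).

Definition spi w : P := pres_pi _ w.

Lemma spi_cat v w : spi (v ++ w) = (spi v * spi w)%g.
Proof. by rewrite -[RHS]/(pres_mul _ _) pres_mulE. Qed.

Lemma spi_nil : spi [::] = 1%g.
Proof. by []. Qed.

Lemma spi_letter i b : spi [:: (i, b)] = (if b then surface_gen i else (surface_gen i)^-1)%g.
Proof.
case: b => //; apply: (mulgI (surface_gen i)); rewrite mulgV.
rewrite -[surface_gen i]/(spi [:: (i, true)]) -spi_cat; apply/pres_piP.
exact: (pres_cancel _ i true).
Qed.

Lemma spi_repr (x : P) : spi (repr x) = x.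
Proof. exact: pres_reprK. Qed.

Definition pi_exponents (x : P) : V := exponents (repr x).

Lemma pi_exponents_spi w : pi_exponents (spi w) = exponents w.
Proof. by have [] := pres_eq_fox (@lattice_geltD g) (@lattice_gelt0 g) (pres_repr _ w). Qed.

Lemma pi_exponentsM x y : pi_exponents (x * y)%g = pi_exponents x + pi_exponents y.
Proof.
by rewrite -(spi_repr x) -(spi_repr y) -spi_cat !pi_exponents_spi exponents_cat.
Qed.

Lemma pi_exponents1 : pi_exponents 1%g = 0.
Proof. by rewrite -spi_nil pi_exponents_spi /exponents big_nil. Qed.

Lemma pi_exponentsV x : pi_exponents (x^-1)%g = - pi_exponents x.
Proof. by apply/eqP; rewrite -addr_eq0 -pi_exponentsM mulVg pi_exponents1. Qed.

Lemma pi_exponents_derived x : derived_pred x -> pi_exponents x = 0.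
Proof.
move=> /asboolP; elim=> {x} [|x y|x y _ IHx _ IHy].
- exact: pi_exponents1.
- rewrite /commg /conjg !pi_exponentsM !pi_exponentsV.
  by rewrite addrA -opprD addNr.
- by rewrite pi_exponentsM pi_exponentsV IHx IHy subrr.
Qed.

Lemma pi_exponents_abel x y : abel_pi x = abel_pi y -> pi_exponents x = pi_exponents y.
Proof.
move/abel_piP/pi_exponents_derived; rewrite pi_exponentsM pi_exponentsV.
by move/eqP; rewrite subr_eq0 => /eqP.
Qed.

Lemma abel_pi_spi w : abel_pi (spi w) = H1_map (exponents w).
Proof.
have H1_map_unit (i : 'I_(2 * g)) : H1_map (unit_row i) = abel_pi (surface_gen i).
  rewrite /H1_map (bigD1 i) //= mxE eqxx mulr1z big1 ?addr0 // => j ji.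
  by rewrite mxE [_ == _ :> nat](negbTE ji) mulr0z.
elim: w => [|[i b] w IHw]; first by rewrite /exponents big_nil raddf0.
rewrite -cat1s spi_cat abel_piM IHw exponents_cat raddfD; congr (_ + _).
rewrite spi_letter exponents1; case: b; rewrite [(_, _).1]/= [(_, _).2]/=.
  by rewrite [RHS]H1_map_unit.
by rewrite abel_piV -H1_map_unit [RHS]raddfN.
Qed.

(** A set-theoretic section; its failure to be multiplicative is measured by [cocycle]. *)
Definition H1_lift h : P := repr (H1_map h).

Lemma abel_pi_lift h : abel_pi (H1_lift h) = H1_map h.
Proof. exact: abel_reprK. Qed.

(** The exponent vector factors additively through the abelianization and sends generators to unit
    vectors, hence undoes [H1_map]: this is the injective half of pi^ab = Z^2g. *)
Lemma pi_exponents_lift h : pi_exponents (H1_lift h) = h.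
Proof.
pose e (a : abel P) := pi_exponents (repr a).
have eE x : e (abel_pi x) = pi_exponents x.
  by apply: pi_exponents_abel; apply: abel_reprK.
have eB : zmod_morphism e.
  move=> a b; rewrite -(abel_reprK a) -(abel_reprK b) -abel_piV -abel_piM !eE.
  by rewrite pi_exponentsM pi_exponentsV.
rewrite -eE abel_pi_lift /H1_map -[e _]/(additive_of eB _) raddf_sum.
apply/rowP => j; rewrite summxE (bigD1 j) //= big1 ?addr0 => [|i ij].
  rewrite -[e _]/(additive_of eB _) raddfMz /= eE -[surface_gen _]/(spi [:: (j, true)]).
  by rewrite pi_exponents_spi exponents1 -scaler_int !mxE eqxx mulr1 intz.
rewrite -[e _]/(additive_of eB _) raddfMz /= eE -[surface_gen _]/(spi [:: (i, true)]).
rewrite pi_exponents_spi exponents1 -scaler_int !mxE eq_sym [_ == _ :> nat](negbTE ij).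
by rewrite mulr0.
Qed.

Lemma surface_scaleE h (m : M) : gelt (h : H1_lattice g) *: m = conj_act (H1_lift h) m.
Proof. by rewrite [LHS]gmod_scaleU mulr1z. Qed.

Fact gen_ord_subproof (u : 'I_N) : (u < 2 * g)%N.
Proof. by rewrite mul2n ltn_kdim1. Qed.

Definition gen_ord (u : 'I_N) : 'I_(2 * g) := Ordinal (gen_ord_subproof u).

Lemma row_additive_eq (W : zmodType) (f f' : {additive 'rV[L]_N -> W}) :
    (forall h (i : 'I_(2 * g)),
      f (T h *: basis_row L g.*2 i) = f' (T h *: basis_row L g.*2 i)) ->
  f =1 f'.
Proof.
move=> ff' x; rewrite (row_sum_delta x) !raddf_sum; apply: eq_bigr => u _.
rewrite (gr_generated (x ord0 u)) scaler_suml !raddf_sum; apply: eq_bigr => h _.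
rewrite -scalerMzl !raddfMz /=; congr (_ *~ _).
have -> : delta_mx ord0 u = basis_row L g.*2 (gen_ord u).
  by apply/rowP => j; rewrite !mxE eqxx.
by rewrite -lattice_geltE ff'.
Qed.

(** The loop that goes to h along the section, reads w in the Cayley graph of Z^2g, and returns
    along the section. *)
Definition transition h w : M :=
  derived_class (H1_lift h * spi w * (H1_lift (h + exponents w))^-1)%g.

Lemma transition_derived h w :
  derived_pred (H1_lift h * spi w * (H1_lift (h + exponents w))^-1)%g.
Proof.
by rewrite derived_predE !abel_piM abel_piV abel_pi_spi !abel_pi_lift raddfD subrr.
Qed.

Lemma transition_cat h v w :
  transition h (v ++ w) = transition h v + transition (h + exponents v) w.
Proof.
rewrite /transition -derived_classM ?transition_derived //; congr derived_class.
by rewrite exponents_cat addrA spi_cat !mulgA mulgVK.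
Qed.

Lemma transition_inv h i :
  transition h [:: (i, false)] = - transition (h - unit_row i) [:: (i, true)].
Proof.
rewrite /transition -derived_classV ?transition_derived //; congr derived_class.
by rewrite !exponents1 /= subrK !spi_letter !invgM invgK mulgA.
Qed.

Fact schreier_entry_is_additive i h :
  zmod_morphism (fun n : int => transition h [:: (i, true)] *~ n).
Proof. by move=> x y; rewrite mulrzBr. Qed.

Definition schreier_entry i : {additive L -> M} :=
  malg_ext (fun h : H1_lattice g => additive_of (schreier_entry_is_additive i h)).

Definition schreier (x : 'rV[L]_N) : M := \sum_u schreier_entry (gen_ord u) (x ord0 u).

Fact schreier_is_additive : zmod_morphism schreier.
Proof.
by move=> x y; rewrite /schreier -sumrB; apply: eq_bigr => u _; rewrite !mxE raddfB.
Qed.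

HB.instance Definition _ := GRing.isZmodMorphism.Build 'rV[L]_N M schreier schreier_is_additive.

Lemma schreierD x y : schreier (x + y) = schreier x + schreier y.
Proof. exact: raddfD. Qed.

Lemma schreierB x y : schreier (x - y) = schreier x - schreier y.
Proof. exact: raddfB. Qed.

Lemma schreierN x : schreier (- x) = - schreier x.
Proof. exact: raddfN. Qed.

Lemma schreier_basis h (i : 'I_(2 * g)) :
  schreier (T h *: basis_row L g.*2 i) = transition h [:: (i, true)].
Proof.
have iN : (i < N)%N by rewrite kdimE bin1 -mul2n.
rewrite /schreier (bigD1 (Ordinal iN)) //= big1 ?addr0 => [|u ui].
  have -> : gen_ord (Ordinal iN) = i by apply/val_inj.
  by rewrite !mxE eqxx mulr1 lattice_geltE [LHS]malg_extU.
rewrite !mxE [_ == _ :> nat](_ : _ = false) ?mulr0 ?raddf0 //.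
by apply/negbTE.
Qed.

(** Reidemeister-Schreier rewriting: [fox w] lists the edges that w traverses, and the loops of
    consecutive edges telescope. *)
Lemma schreier_fox h w : schreier (T h *: fox w) = transition h w.
Proof.
elim: w h => [|l w IHw] h.
  rewrite /= scaler0 raddf0 /transition spi_nil /exponents big_nil addr0 mulg1 mulgV.
  by rewrite derived_class1.
rewrite (scale_fox_cons (@lattice_geltD g)) schreierD -[l :: w]cat1s transition_cat.
apply: (f_equal2 +%R); last exact: IHw.
case: l => i [].
  exact: schreier_basis.
by rewrite (scale_fox_letter_inv (@lattice_geltD g)) schreierN schreier_basis transition_inv.
Qed.

Definition bdry0 (x : 'rV[L]_N) : L := (x *m koszul (@tvar g) 0 g.*2) ord0 ord0.

Fact bdry0_is_additive : zmod_morphism bdry0.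
Proof. by move=> x y; rewrite /bdry0 mulmxBl [LHS]mxE [X in _ + X = _]mxE. Qed.

HB.instance Definition _ := GRing.isZmodMorphism.Build 'rV[L]_N L bdry0 bdry0_is_additive.

Lemma bdry0_basis h (i : 'I_(2 * g)) :
  bdry0 (T h *: basis_row L g.*2 i) = T (h + unit_row i) - T h.
Proof.
by rewrite /bdry0 (scale_basis_row_koszul (@lattice_geltD g)) mxE eqxx mulr1n.
Qed.

Lemma bdry0_eq0 x : bdry0 x = 0 -> x *m koszul (@tvar g) 0 g.*2 = 0.
Proof.
move=> x0; rewrite [LHS](mx11_scalar (_ : 'M_1)) -[X in X%:M]/(bdry0 x) x0.
exact: raddf0.
Qed.

Lemma bdry0_fox w : bdry0 (fox w) = T (exponents w) - 1.
Proof. by rewrite /bdry0 (fox_koszul (@lattice_geltD g) (@lattice_gelt0 g)) mxE eqxx mulr1n. Qed.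

Definition cocycle h h' : M :=
  derived_class (H1_lift (h + h') * (H1_lift h * H1_lift h')^-1)%g.

Fact cocycle_is_additive h h' : zmod_morphism (fun n : int => cocycle h h' *~ n).
Proof. by move=> x y; rewrite mulrzBr. Qed.

Definition cocycle_map h : {additive L -> M} :=
  malg_ext (fun h' : H1_lattice g => additive_of (cocycle_is_additive h h')).

Lemma cocycle_mapT h h' : cocycle_map h (T h') = cocycle h h'.
Proof. by rewrite lattice_geltE [LHS]malg_extU. Qed.

Lemma transition_shift h h' w :
  transition (h + h') w =
  gelt (h : H1_lattice g) *: transition h' w - (cocycle h (h' + exponents w) - cocycle h h').
Proof.
have coD k : derived_pred (H1_lift (h + k) * (H1_lift h * H1_lift k)^-1)%g.
  by rewrite derived_predE abel_piM abel_piV abel_piM !abel_pi_lift raddfD subrr.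
rewrite surface_scaleE -derived_classJ ?transition_derived // opprB addrCA.
rewrite /cocycle -derived_classV // -derived_classM ?derivedJ ?derivedV ?transition_derived //.
rewrite -derived_classM //; last by rewrite derivedM ?derivedJ ?derivedV ?transition_derived.
congr derived_class; rewrite !invgM !invgK !mulgA !mulgVK addrA.
by rewrite ?mulgVK.
Qed.

(** Translating a loop moves its two base points on the section, and each move costs a cocycle
    value. The total cost depends only on the boundary of x, so the map is linear on cycles. *)
Lemma schreier_scale h x :
  schreier (T h *: x) = gelt (h : H1_lattice g) *: schreier x - cocycle_map h (bdry0 x).
Proof.
have fB : zmod_morphism (fun x => schreier (T h *: x)).
  by move=> y z; rewrite scalerBr schreierB.
have fB' : zmod_morphism (fun x => gelt (h : H1_lattice g) *: schreier x).
  by move=> y z; rewrite schreierB scalerBr.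
suff: additive_of fB =1 additive_of fB' \- (cocycle_map h \o bdry0) by apply.
apply: row_additive_eq => h' i; set b := basis_row _ _ _.
change (schreier (T h *: (T h' *: b)) =
  gelt (h : H1_lattice g) *: schreier (T h' *: b) - cocycle_map h (bdry0 (T h' *: b))).
have E1 : schreier (T h *: (T h' *: b)) = transition (h + h') [:: (i, true)].
  exact: etrans (congr1 schreier (scaleTA (@lattice_geltD g) h h' b)) (schreier_basis _ _).
have E2 : cocycle_map h (bdry0 (T h' *: b)) = cocycle h (h' + unit_row i) - cocycle h h'.
  rewrite -!cocycle_mapT -raddfB.
  exact: congr1 (bdry0_basis h' i).
apply: etrans E1 _; apply: etrans (transition_shift _ _ _) _.
apply: (f_equal2 (fun m m' : M => m - m')).
  exact: congr1 (esym (schreier_basis h' i)).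
by rewrite exponents1; apply: esym E2.
Qed.
End Surface.

(** * The Fox derivative as inverse of the Reidemeister-Schreier map *)

Section Surface.
Variable g : nat.
Local Notation V := 'rV[int]_(2 * g).
Local Notation L := (gring (H1_lattice g)).
Local Notation P := (surface_group g).
Local Notation M := (surface_module g).
Local Notation T := (@lattice_gelt g).
Local Notation unit_row := (unit_row g).
Local Notation N := (kdim 1 g.*2).
Local Notation fox := (fox T).
Local Notation relator := (fox (surface_relator g)).
Local Notation H1_lift := (@H1_lift g).
Implicit Types (w : word 'I_(2 * g)) (h : V) (x y : P).

Lemma spi_inv w : spi (word_inv w) = (spi w)^-1%g.
Proof.
apply: (mulgI (spi w)); rewrite mulgV -spi_cat; apply/pres_piP.
exact: pres_eq_invr.
Qed.

Definition relator_multiple (v : 'rV[L]_N) : Prop := exists l : L, v = l *: relator.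

Definition fox_quot : zmodType := zquot relator_multiple.
Definition fox_pi : {additive 'rV[L]_N -> fox_quot} :=
  \pi_(Quotient.quot (zspan_pred relator_multiple)).

Lemma fox_pi_eq0 v : fox_pi v = 0 <-> relator_multiple v.
Proof.
split=> [/eqP|rv].
  rewrite [_ == _]quot_eq0 => /asboolP; elim=> [|//|x y _ [l ->] _ [m ->]].
    by exists 0; rewrite scale0r.
  by exists (l - m); rewrite scalerBl.
by apply/eqP; rewrite [_ == _]quot_eq0; apply/asboolP/zspan_gen.
Qed.

Definition fox_class (x : P) : fox_quot := fox_pi (fox (repr x)).

Lemma fox_class_spi w : fox_class (spi w) = fox_pi (fox w).
Proof.
apply/eqP; rewrite -subr_eq0 /fox_class -raddfB; apply/eqP/fox_pi_eq0.
by have [] := pres_eq_fox (@lattice_geltD g) (@lattice_gelt0 g) (pres_repr _ w).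
Qed.

(** Zero exponent of the first factor removes the twist in the product rule. *)
Lemma fox_classM x y : pi_exponents x = 0 ->
  fox_class (x * y)%g = fox_class x + fox_class y.
Proof.
move=> x0; rewrite -[in LHS](spi_repr x) -[in LHS](spi_repr y) -spi_cat fox_class_spi.
rewrite (fox_cat (@lattice_geltD g) (@lattice_gelt0 g)) [X in T X](_ : _ = 0) // (@lattice_gelt0 g) scale1r.
exact: raddfD.
Qed.

Lemma fox_class1 : fox_class 1%g = 0.
Proof. by rewrite -spi_nil fox_class_spi raddf0. Qed.

Lemma fox_classV x : pi_exponents x = 0 -> fox_class (x^-1)%g = - fox_class x.
Proof.
by move=> x0; apply/eqP; rewrite -addr_eq0 addrC -fox_classM // mulgV fox_class1.
Qed.

Lemma fox_class_derived (d : derived P) : derived_pred d -> fox_class (val d) = 0.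
Proof.
have d0 (e : derived P) : pi_exponents (val e) = 0.
  exact/pi_exponents_derived/valP.
move/asboolP; elim=> {d} [|x y|x y _ IHx _ IHy].
- exact: fox_class1.
- rewrite /commg /conjg !gmulfM !gmulfV /= !fox_classM ?pi_exponentsM ?pi_exponentsV ?d0 ?oppr0 ?addr0 //.
  by rewrite !fox_classV ?d0 // addrA -opprD addNr.
- by rewrite gmulfM gmulfV /= fox_classM ?d0 // fox_classV ?d0 // IHx IHy subrr.
Qed.

Definition fox_derived (m : M) : fox_quot := fox_class (val (repr (m : abel (derived P)))).

Lemma fox_derived_class x : derived_pred x -> fox_derived (derived_class x) = fox_class x.
Proof.
move=> Dx; rewrite -[x]/(val (Derived Dx)) derived_classE; set d := Derived Dx.
apply/eqP; rewrite -subr_eq0; apply/eqP; rewrite /fox_derived.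
have e0 (e : derived P) : pi_exponents (val e) = 0.
  exact/pi_exponents_derived/valP.
rewrite -[RHS](fox_class_derived (abel_repr d)) gmulfM gmulfV /=.
by rewrite fox_classM ?fox_classV //; [apply: (e0 d) | apply: e0].
Qed.

Fact fox_derived_is_additive : zmod_morphism fox_derived.
Proof.
have pE (d : derived P) : fox_derived (abel_pi d) = fox_class (val d).
  by rewrite -fox_derived_class ?derived_classE //; apply: valP.
have e0 (e : derived P) : pi_exponents (val e) = 0.
  exact/pi_exponents_derived/valP.
move=> m n; rewrite -(abel_reprK m) -(abel_reprK n) -abel_piV -abel_piM !pE.
by rewrite gmulfM gmulfV /= fox_classM ?fox_classV ?e0.
Qed.

HB.instance Definition _ := GRing.isZmodMorphism.Build M fox_quot fox_derived fox_derived_is_additive.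

Fact lift_fox_is_additive h :
  zmod_morphism (fun n : int => fox (repr (H1_lift h)) *~ n).
Proof. by move=> x y; rewrite mulrzBr. Qed.

Definition lift_fox : {additive L -> 'rV[L]_N} :=
  malg_ext (fun h : H1_lattice g => additive_of (lift_fox_is_additive h)).

Lemma lift_foxT h : lift_fox (T h) = fox (repr (H1_lift h)).
Proof. by rewrite lattice_geltE [LHS]malg_extU. Qed.

(** On a single edge this is [fox_transition]: the error is the difference of the section words at
    its ends, an additive function of the boundary, so the composite is the projection on cycles. *)
Lemma fox_derived_schreier (v : 'rV[L]_N) : fox_derived (schreier v) = fox_pi v - fox_pi (lift_fox (bdry0 v)).
Proof.
suff: fox_derived \o @schreier g =1 fox_pi \- (fox_pi \o lift_fox \o @bdry0 g) by apply.
apply: row_additive_eq => h i; set b := basis_row _ _ _.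
change (fox_derived (schreier (T h *: b)) = fox_pi (T h *: b) - fox_pi (lift_fox (bdry0 (T h *: b)))).
rewrite schreier_basis /transition fox_derived_class ?transition_derived //.
have -> : lift_fox (bdry0 (T h *: b)) =
    fox (repr (H1_lift (h + unit_row i))) - fox (repr (H1_lift h)).
  by rewrite -!lift_foxT -raddfB; exact: congr1 (bdry0_basis h i).
have -> : (H1_lift h * spi [:: (i, true)] * (H1_lift (h + exponents [:: (i, true)]))^-1)%g =
    spi (repr (H1_lift h) ++ (i, true) :: word_inv (repr (H1_lift (h + unit_row i)))).
  by rewrite exponents1 -[_ :: word_inv _]cat1s !spi_cat spi_inv !spi_repr mulgA.
have eh k : exponents (repr (H1_lift k)) = k := pi_exponents_lift k.
have E : fox (repr (H1_lift h) ++ (i, true) :: word_inv (repr (H1_lift (h + unit_row i)))) =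
    fox (repr (H1_lift h)) + T h *: b - fox (repr (H1_lift (h + unit_row i))).
  have := @fox_transition g _ T (@lattice_geltD g) (@lattice_gelt0 g) (repr (H1_lift h)) i
    (repr (H1_lift (h + unit_row i))).
  by rewrite !eh; apply.
apply: etrans (fox_class_spi _) _; apply: etrans (congr1 fox_pi E) _.
move: (fox _) (fox _) (T h *: b) => c d e.
by rewrite -raddfB opprB addrA [e + _]addrC.
Qed.

Lemma schreier_kernel (v : 'rV[L]_N) : bdry0 v = 0 -> schreier v = 0 -> relator_multiple v.
Proof.
move=> v0 pv0; apply/fox_pi_eq0; have := fox_derived_schreier v; rewrite v0 pv0.
rewrite (raddf0 lift_fox) (raddf0 fox_pi) subr0 => <-.
exact: raddf0.
Qed.
End Surface.

(** * A free resolution of the surface module *)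

Section SurfaceResolution.
Variable g : nat.
Hypothesis g_gt0 : (0 < g)%N.
Local Notation V := 'rV[int]_(2 * g).
Local Notation L := (gring (H1_lattice g)).
Local Notation P := (surface_group g).
Local Notation M := (surface_module g).
Local Notation T := (@lattice_gelt g).
Local Notation fox := (fox T).
Local Notation K m := (koszul (@tvar g) m g.*2).
Local Notation Omega := (relator_chain T g).

Lemma surface_koszul_exact m (x : 'rV[L]_(kdim m.+1 g.*2)) :
  x *m K m = 0 -> exists y, x = y *m K m.+1.
Proof.
by apply: (@koszul_exact L (@tvar g) (2 * g)) => [k b|]; [apply: tvar_regular | rewrite mul2n].
Qed.

Lemma Omega_koszul : Omega *m K 1 = fox (surface_relator g).
Proof. by rewrite (fox_relator (@lattice_geltD g) (@lattice_gelt0 g)); apply: relator_chain_koszul. Qed.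

Lemma relator_regular (l : L) : l *: fox (surface_relator g) = 0 -> l = 0.
Proof.
rewrite (fox_relator (@lattice_geltD g) (@lattice_gelt0 g)) => l0; apply: (@tvar_nonzerodiv g 1).
  by case: g g_gt0 => // g' _; rewrite mulnS.
by apply: (relator_row_regular (@lattice_geltD g) (@lattice_gelt0 g)) l0; rewrite double_gt0.
Qed.

Lemma bdry0_koszul (x : 'rV[L]_(kdim 2 g.*2)) : bdry0 (x *m K 1) = 0.
Proof. by rewrite /bdry0 -mulmxA koszul_koszul mulmx0 mxE. Qed.

Lemma schreier_scale_cycle (a : L) x : bdry0 x = 0 -> schreier (a *: x) = a *: schreier x.
Proof.
move=> x0; have fB : zmod_morphism (fun a : L => schreier (a *: x)).
  by move=> b c; rewrite scalerBl schreierB.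
have fB' : zmod_morphism (fun a : L => a *: schreier x) by move=> b c; rewrite scalerBl.
suff: additive_of fB =1 additive_of fB' by apply.
apply: lattice_additive_eq => h.
change (schreier (T h *: x) = T h *: schreier x).
apply: etrans (schreier_scale h x) _.
apply: (canLR (addrK _)); rewrite x0 [X in _ + X](raddf0 (cocycle_map h)) addr0.
by rewrite lattice_geltE.
Qed.

Definition augment (x : 'rV[L]_(kdim 2 g.*2)) : M := schreier (x *m K 1).

Fact augment_is_additive : zmod_morphism augment.
Proof. by move=> x y; rewrite /augment mulmxBl schreierB. Qed.

Fact augment_is_scalable : scalable augment.
Proof.
by move=> a x; rewrite /augment -scalemxAl schreier_scale_cycle // bdry0_koszul.
Qed.

HB.instance Definition _ :=
  GRing.isZmodMorphism.Build 'rV[L]_(kdim 2 g.*2) M augment augment_is_additive.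
HB.instance Definition _ :=
  GRing.isScalable.Build L 'rV[L]_(kdim 2 g.*2) M *:%R augment augment_is_scalable.

Lemma augment_surj m : exists x, augment x = m.
Proof.
have mE := abel_reprK (m : abel (derived P)).
move: mE; set d := repr _; move: d => d mE.
have d0 : exponents (repr (val d)) = 0 by apply/pi_exponents_derived/valP.
have [|x xE] := @surface_koszul_exact 0 (fox (repr (val d))).
  by apply: bdry0_eq0; rewrite bdry0_fox d0 lattice_gelt0 subrr.
exists x; rewrite /augment -xE.
(* The section at 0 may differ from 1, but it lies in the derived subgroup and so acts trivially on
   M. *)
have D0 : derived_pred (H1_lift (0 : V)).
  by rewrite derived_predE abel_pi_lift raddf0.
have -> : fox (repr (val d)) = T 0 *: fox (repr (val d)) by rewrite lattice_gelt0 scale1r.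
rewrite schreier_fox /transition d0 addr0 spi_repr derived_classJ; last exact: valP.
by rewrite derived_classE mE conj_act_derived.
Qed.

Lemma schreier_relator (l : L) : schreier (l *: fox (surface_relator g)) = 0.
Proof.
rewrite schreier_scale_cycle; last by rewrite -Omega_koszul bdry0_koszul.
suff -> : schreier (fox (surface_relator g)) = 0 by rewrite scaler0.
have -> : fox (surface_relator g) = T 0 *: fox (surface_relator g) by rewrite lattice_gelt0 scale1r.
have relator1 : pres_eq (fun r : word 'I_(2 * g) => r = surface_relator g)
  (surface_relator g) [::] by apply: pres_rel.
rewrite schreier_fox /transition (pres_eq_fox (@lattice_geltD g) (@lattice_gelt0 g) relator1).1.
rewrite [spi _](_ : _ = 1%g); last exact/pres_piP.
by rewrite /exponents big_nil addr0 mulg1 mulgV derived_class1.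
Qed.

(** If x maps to a multiple l r in Z_1, then x - l [Omega] is a Koszul cycle, hence a boundary from
    K_3. *)
Lemma augment_kernel x :
  augment x = 0 <-> exists y, x = y *m col_mx (K 2) Omega.
Proof.
split=> [|[y ->]]; last first.
  rewrite /augment -mulmxA mul_col_mx koszul_koszul Omega_koszul.
  rewrite -[y]hsubmxK mul_row_col mulmx0 add0r [rsubmx y]mx11_scalar mul_scalar_mx.
  exact: schreier_relator.
move/(schreier_kernel (bdry0_koszul x)) => [l xl].
have [|y yE] := @surface_koszul_exact 1 (x - l *: Omega).
  by rewrite mulmxBl xl -scalemxAl Omega_koszul subrr.
exists (row_mx y l%:M); rewrite mul_row_col mul_scalar_mx -yE subrK.
by [].
Qed.

Definition res_rank k : nat :=
  if k is 1 then (kdim 3 g.*2 + 1)%N else kdim k.+2 g.*2.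

Definition res_mx k : 'M[L]_(res_rank k.+1, res_rank k) :=
  match k with
  | 0 => col_mx (K 2) Omega
  | 1 => row_mx (K 3) 0
  | k'.+2 => K k'.+4
  end.

Lemma res_exact : exact_seq res_mx.
Proof.
split=> [[|[|k]]|[|[|k]] x].
- change (row_mx (K 3) 0 *m col_mx (K 2) Omega = 0).
  by rewrite mul_row_col koszul_koszul mul0mx addr0.
- change (K 4 *m @row_mx _ _ (kdim 3 g.*2) 1 (K 3) 0 = 0).
  by rewrite mul_mx_row koszul_koszul mulmx0 row_mx0.
- exact: koszul_koszul.
- move: x => /= x; rewrite -[x]hsubmxK; move: (lsubmx x) (rsubmx x) => a b.
  change (row_mx a b *m col_mx (K 2) Omega = 0 -> exists y, row_mx a b = y *m row_mx (K 3) 0).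
  rewrite mul_row_col => ab0.
  (* Applying K_2 -> K_1 kills the Koszul part and leaves b r = 0. *)
  have b0 : b = 0.
    rewrite [b]mx11_scalar (@relator_regular (b ord0 ord0)) ?raddf0 //.
    rewrite -mul_scalar_mx -mx11_scalar -Omega_koszul mulmxA.
    have : (a *m K 2 + b *m Omega) *m K 1 = 0 by rewrite ab0 mul0mx.
    rewrite mulmxDl [X in X + _](_ : _ = 0) ?add0r //.
    exact: (koszul_koszul_row (@tvar g) (m := 1) a).
  move: ab0; rewrite b0 mul0mx addr0 => /surface_koszul_exact[y ->].
  by exists y; rewrite mul_mx_row mulmx0.
- change (x *m @row_mx _ _ (kdim 3 g.*2) 1 (K 3) 0 = 0 -> exists y, x = y *m K 4).
  rewrite mul_mx_row => x0; apply: surface_koszul_exact.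
  by rewrite -[LHS](row_mxKl _ (x *m (0 : 'M_(_, 1)))) x0 linear0.
- exact: surface_koszul_exact.
Qed.
End SurfaceResolution.

(** * Quotients by a unimodular vector *)

(** Smith normal form makes w a multiple of the first row of an invertible R; the value 1 forces
    that multiple to be a unit. The quotient map forgets the first coordinate in the basis of rows
    of R. *)
Lemma unimodular_row_quotient k (w : 'rV[int]_k) (f : {additive 'rV[int]_k -> int}) :
    f w = 1 -> exists q : {additive 'rV[int]_k -> 'rV[int]_k.-1},
  (forall y, exists x, q x = y) /\ (forall x, q x = 0 <-> exists c, x = w *~ c).
Proof.
case: k w f => [|k] w f fw.
  by move: fw; rewrite (_ : w = 0) ?raddf0 //; apply/rowP => -[].
have [E _ [R R_unit [d _ wE]]] := int_Smith_normal_form w.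
pose r : 'rV[int]_k.+1 := row ord0 R.
pose u := E ord0 ord0 * d`_0.
have {}wE : w = r *~ u.
  rewrite {1}wE [E]mx11_scalar mul_scalar_mx -scalemxAl -scaler_int intz /u -scalerA.
  congr (_ *: _); rewrite /r; apply/rowP => j.
  rewrite !mxE (bigD1 ord0) //= big1 ?addr0 => [|i i0]; first by rewrite !mxE.
  by rewrite !mxE /= [_ == _ :> nat]eq_sym [_ == _ :> nat](negbTE i0) mul0r.
have ufr : u * f r = 1 by rewrite -fw wE raddfMz /= mulrzz mulrC.
pose q (x : 'rV[int]_k.+1) : 'rV[int]_k := @rsubmx _ 1 1 k (x *m invmx R).
have qB : zmod_morphism q by move=> x y; rewrite /q mulmxBl linearB.
exists (additive_of qB); split=> [y|x] /=.
  by exists ((@row_mx _ 1 1 k 0 y) *m R); rewrite /q mulmxK // row_mxKr.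
have rE : r *m invmx R = @row_mx _ 1 1 k 1%:M 0.
  rewrite /r -row_mul mulmxV //; apply/rowP => j; rewrite !mxE.
  by case: splitP => l lE; rewrite !mxE -val_eqE /= lE ?ord1.
split=> [qx0|[c ->]]; last first.
  rewrite -[q _]/(additive_of qB _) raddfMz /= wE -[q _]/(additive_of qB _) raddfMz /=.
  by rewrite /q rE row_mxKr !mul0rz.
pose a := (@lsubmx _ 1 1 k (x *m invmx R)) ord0 ord0.
have xE : x = r *~ a.
  rewrite -[LHS](mulmxKV R_unit) -[RHS](mulmxKV R_unit); congr (_ *m _).
  rewrite -[X in X = _](@hsubmxK _ 1 1 k) -[rsubmx _]/(q x) qx0 [lsubmx _]mx11_scalar -/a.
  rewrite -scaler_int intz -scalemxAl rE (@scale_row_mx _ 1 1 k) scaler0.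
  by rewrite scale_scalar_mx mulr1.
(* Since u times f r is 1, r equals w times f r. *)
by exists (a * f r); rewrite wE -mulrzA mulrCA ufr mulr1.
Qed.

Lemma unimodular_quotient (X : zmodType) k (w : X) (f : {additive X -> int}) :
    zmod_iso X 'rV[int]_k -> f w = 1 ->
  exists q : {additive X -> 'rV[int]_k.-1},
  (forall y, exists x, q x = y) /\ (forall x, q x = 0 <-> exists c, x = w *~ c).
Proof.
move=> [h hb] fw; have [[h' hK h'K]] := (hb, hb).
have h'B : zmod_morphism h'.
  by move=> x y; apply: (can_inj hK); rewrite raddfB !h'K.
have [|q [q_surj q_ker]] := @unimodular_row_quotient _ (h w) (f \o additive_of h'B).
  by rewrite /= hK.
exists (q \o h); split=> [y|x] /=.
  by have [x <-] := q_surj y; exists (h' x); rewrite h'K.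
split=> [/q_ker[c xc]|[c ->]].
  by exists c; apply: (can_inj hK); rewrite xc raddfMz.
by apply/q_ker; exists c; rewrite raddfMz.
Qed.

Section Quotient.
Variables (X : zmodType) (Q : X -> Prop).

Definition zquot_pi : {additive X -> zquot Q} := \pi_(Quotient.quot (zspan_pred Q)).

Lemma zquot_pi_eq0 x : zquot_pi x = 0 <-> zspan Q x.
Proof.
split=> [/eqP|xQ]; first by rewrite [_ == _]quot_eq0 => /asboolP.
by apply/eqP; rewrite [_ == _]quot_eq0; apply/asboolP.
Qed.

Lemma zquot_pi_surj y : exists x, zquot_pi x = y.
Proof. by exists (repr y); apply: reprK. Qed.

Lemma zspan_kernel (W : zmodType) (f : {additive X -> W}) :
  (forall x, Q x -> f x = 0) -> forall x, zspan Q x -> f x = 0.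
Proof.
move=> fQ x; elim=> [|y /fQ //|y z _ fy _ fz]; first exact: raddf0.
by rewrite raddfB /= fy fz subrr.
Qed.

Lemma zquot_lift (W : zmodType) (f : {additive X -> W}) :
    (forall x, Q x -> f x = 0) ->
  exists h : {additive zquot Q -> W}, forall x, h (zquot_pi x) = f x.
Proof.
move=> /zspan_kernel fQ; pose h (y : zquot Q) := f (repr y).
have hE x : h (zquot_pi x) = f x.
  apply/eqP; rewrite -subr_eq0 -raddfB; apply/eqP/fQ/zquot_pi_eq0.
  by rewrite raddfB /= [X in X - _]reprK subrr.
have hB : zmod_morphism h.
  move=> y z; have [[u <-] [v <-]] := (zquot_pi_surj y, zquot_pi_surj z).
  by rewrite -raddfB !hE raddfB.
by exists (additive_of hB).
Qed.

Lemma zquot_iso (W : zmodType) (q : {additive X -> W}) :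
    (forall y, exists x, q x = y) -> (forall x, q x = 0 <-> zspan Q x) ->
  zmod_iso (zquot Q) W.
Proof.
move=> q_surj q_ker; have [x Qx|h hE] := @zquot_lift _ q; first exact/q_ker/zspan_gen.
exists h; apply: inj_surj_bijective => [y z yz|w]; last first.
  by have [x <-] := q_surj w; exists (zquot_pi x).
apply/eqP; rewrite -subr_eq0; apply/eqP; move: yz.
have [[u <-] [v <-]] := (zquot_pi_surj y, zquot_pi_surj z).
rewrite !hE -raddfB => uv; apply/zquot_pi_eq0/q_ker.
by rewrite raddfB /= uv subrr.
Qed.
End Quotient.

Lemma zspan1 (X : zmodType) (w x : X) :
  zspan (fun y => y = w) x <-> exists c, x = w *~ c.
Proof.
split=> [|[c ->]].
  elim=> [|_ ->|_ _ _ [c ->] _ [d ->]]; first by exists 0; rewrite mulr0z.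
    by exists 1; rewrite mulr1z.
  by exists (c - d); rewrite mulrzBr.
have w_nat n : zspan (fun y => y = w) (w *+ n).
  elim: n => [|n IHn]; first exact: zspan0.
  rewrite mulrSr -[X in _ + X]opprK -[- w]sub0r.
  by apply: zspanB => //; apply: zspanB; [apply: zspan0 | apply: zspan_gen].
case: c => n; first exact: w_nat.
by rewrite NegzE mulrNz -sub0r; apply: zspanB; [apply: zspan0 | apply: w_nat].
Qed.

(** * Exterior powers of Z^n *)

Section Wedge.
Variables (m : nat) (V : zmodType).
Implicit Types (t : {ffun 'I_m -> V}) (i j : 'I_m) (x y : V).

Lemma wedgeE t : wedge t = zquot_pi (@ext_rel m V) << t >>.
Proof. by []. Qed.

Lemma wedge_updD t i x y :
  wedge (upd t i (x + y)) = wedge (upd t i x) + wedge (upd t i y).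
Proof.
rewrite !wedgeE -raddfD; apply/eqP; rewrite -subr_eq0 -raddfB; apply/eqP/zquot_pi_eq0.
by rewrite opprD addrA; apply/zspan_gen/ext_rel_add.
Qed.

Lemma wedge_alt t i j : i != j -> t i = t j -> wedge t = 0.
Proof. by move=> ij tij; apply/zquot_pi_eq0/zspan_gen; apply: ext_rel_alt tij. Qed.

Fact wedge_upd_is_additive t i : zmod_morphism (fun x => wedge (upd t i x)).
Proof.
by move=> x y; apply/eqP; rewrite eq_sym subr_eq -wedge_updD subrK.
Qed.

Lemma upd_id t i : upd t i (t i) = t.
Proof. by apply/ffunP => j; rewrite ffunE; case: eqP => [->|]. Qed.

Lemma updC t i j x y : i != j -> upd (upd t i x) j y = upd (upd t j y) i x.
Proof.
move=> ij; apply/ffunP => k; rewrite !ffunE.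
by case: (k =P j) => [->|//]; rewrite eq_sym (negbTE ij).
Qed.

(** Polarization: expand the vanishing value at x + y in both slots. *)
Lemma wedge_tperm t i j : i != j -> wedge [ffun k => t (tperm i j k)] = - wedge t.
Proof.
move=> ij; pose f x y := wedge (upd (upd t i x) j y).
have fDl x x' y : f (x + x') y = f x y + f x' y.
  by rewrite /f ![upd (upd t i _) j _]updC // wedge_updD.
have fDr x y y' : f x (y + y') = f x y + f x y' by rewrite /f wedge_updD.
have fxx x : f x x = 0.
  by apply: (@wedge_alt _ i j) => //; rewrite !ffunE eqxx (negbTE ij) eqxx.
have fC x y : f x y = - f y x.
  apply/eqP; rewrite -addr_eq0; have := fxx (x + y).
  by rewrite fDl !fDr !fxx add0r addr0 => /eqP.
have -> : [ffun k => t (tperm i j k)] = upd (upd t i (t j)) j (t i).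
  apply/ffunP => k; rewrite !ffunE.
  by case: tpermP => [->|->|/eqP/negbTE-> /eqP/negbTE-> //]; rewrite ?eqxx ?(negbTE ij).
by rewrite -/(f _ _) fC /f !upd_id.
Qed.

Lemma wedge_perm t (s : 'S_m) : exists b : bool,
  wedge [ffun k => t (s k)] = if b then wedge t else - wedge t.
Proof.
have [ts -> ts_pair] := prod_tpermP s; elim: ts ts_pair => [|[i j] ts IHts] /=.
  move=> _; exists true; congr wedge; apply/ffunP => k.
  by rewrite ffunE big_nil perm1.
case/andP => ij /IHts[b bE]; exists (~~ b).
pose t' := [ffun k => t ((\prod_(p <- ts) tperm p.1 p.2)%g k)].
transitivity (wedge [ffun k => t' (tperm i j k)]).
  by congr wedge; apply/ffunP => k; rewrite !ffunE big_cons permM.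
by rewrite wedge_tperm // bE; case: b {bE}; rewrite ?opprK.
Qed.

Lemma ext_lift (W : zmodType) (F : {ffun 'I_m -> V} -> W) :
    (forall t i x y, F (upd t i (x + y)) = F (upd t i x) + F (upd t i y)) ->
    (forall t i j, i != j -> t i = t j -> F t = 0) ->
  exists h : {additive extpow m V -> W}, forall t, h (wedge t) = F t.
Proof.
move=> FD Falt.
have Fmul_additive t : zmod_morphism (fun n : int => F t *~ n).
  by move=> x y; rewrite mulrzBr.
have [f fU] : exists f : {additive {malg int[{ffun 'I_m -> V}]} -> W},
    forall t, f << t >> = F t.
  by exists (malg_ext (fun t => additive_of (Fmul_additive t))) => t; rewrite [LHS]malg_extU /= mulr1z.
have [_ [t i x y|t i j ij tij]|h hE] := @zquot_lift _ (@ext_rel m V) _ f.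
- by rewrite !raddfB /= !fU FD -addrA -opprD subrr.
- by rewrite fU (Falt _ i j).
by exists h => t; rewrite -fU -hE.
Qed.

Lemma ext_generated (S : extpow m V -> Prop) :
    S 0 -> (forall e e', S e -> S e' -> S (e - e')) -> (forall t, S (wedge t)) ->
  forall e, S e.
Proof.
move=> S0 SB Sw e; have SN d : S d -> S (- d) by rewrite -sub0r; apply: SB.
have SD c d : S c -> S d -> S (c + d) by move=> Sc /SN /(SB _ _ Sc); rewrite opprK.
have SMn d n : S d -> S (d *+ n).
  by move=> Sd; elim: n => // n IHn; rewrite mulrS; apply: SD.
have SMz d n : S d -> S (d *~ n).
  by move=> Sd; case: n => n; rewrite ?NegzE ?mulrNz; [|apply: SN]; apply: SMn.
have [c <-] := zquot_pi_surj e; rewrite (monalgE c) raddf_sum.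
elim/big_ind: _ => // t _; rewrite -[c@_t]intz raddfMz /= raddfMz.
exact/SMz/Sw.
Qed.
End Wedge.

Section ExteriorBasis.
Variables (m n : nat).
Local Notation V := 'rV[int]_n.
Local Notation E := (extpow m V).

Definition wedge_index : predArgType :=
  {t : m.-tuple 'I_n | sorted ltn [seq val i | i <- t]}.

Lemma card_wedge_index : #|wedge_index| = 'C(n, m).
Proof. by rewrite card_sig -card_ltn_sorted_tuples cardsE. Qed.

Definition basis_fun (f : 'I_m -> 'I_n) : {ffun 'I_m -> V} :=
  [ffun i => delta_mx ord0 (f i)].

Definition basis_wedge (s : wedge_index) : E := wedge (basis_fun (tnth (val s))).

(** The coordinate functionals of the exterior power, dual to [basis_wedge] by [minor_basis]. *)
Definition minor (s : 'I_m -> 'I_n) (t : {ffun 'I_m -> V}) : int :=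
  \det (\matrix_(i, j) t i ord0 (s j)).

Lemma minor_updD s t i x y :
  minor s (upd t i (x + y)) = minor s (upd t i x) + minor s (upd t i y).
Proof.
rewrite -[minor s (upd t i x)]mul1r -[minor s (upd t i y)]mul1r.
apply: (@determinant_multilinear _ _ _ _ _ i).
- by rewrite !scale1r; apply/rowP => j; rewrite !mxE !ffunE eqxx !mxE.
- by apply/matrixP => k j; rewrite !mxE !ffunE eq_sym (negbTE (neq_lift _ _)).
- by apply/matrixP => k j; rewrite !mxE !ffunE eq_sym (negbTE (neq_lift _ _)).
Qed.

Lemma minor_alt s (t : {ffun 'I_m -> V}) i j : i != j -> t i = t j -> minor s t = 0.
Proof.
by move=> ij tij; apply: (determinant_alternate ij) => k; rewrite !mxE tij.
Qed.

Lemma minor_basis (s s' : wedge_index) :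
  minor (tnth (val s)) (basis_fun (tnth (val s'))) = (s == s')%:R.
Proof.
have index_uniq (r : wedge_index) : uniq (val r).
  by rewrite -(map_inj_uniq val_inj) (sorted_uniq ltn_trans ltnn) //; apply: (valP r).
case: eqP => [<-|ss'].
  rewrite /minor -[RHS](@det1 _ m); congr (\det _); apply/matrixP => i j.
  rewrite !mxE ffunE mxE eqxx /= (inj_eq (tuple_uniqP _ (index_uniq s))).
  by rewrite eq_sym.
(* Distinct sets of the same size are not nested; the missing element gives a zero column. *)
have [j js'] : exists j, tnth (val s) j \notin val s'.
  apply/existsP; apply: contraT; rewrite negb_exists => /forallP sub.
  case: ss'; apply/val_inj/val_inj/(inj_map val_inj).
  apply: (irr_sorted_eq ltn_trans ltnn) => [||k]; [exact: (valP s)|exact: (valP s')|].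
  have ss' : {subset val s <= val s'}.
    by move=> _ /tnthP[j ->]; have := sub j; rewrite negbK.
  have [|_ eq_ss'] := uniq_min_size (index_uniq s) ss'; first by rewrite !size_tuple.
  by apply/mapP/mapP => -[l ls ->]; exists l => //; rewrite ?eq_ss' // -eq_ss'.
rewrite /minor (expand_det_col _ j) big1 // => i _; rewrite !mxE ffunE mxE eqxx /=.
case: eqP => [e|_]; last by rewrite mul0r.
by case/negP: js'; rewrite e mem_tnth.
Qed.

Definition wedge_span (e : E) := exists c : {ffun wedge_index -> int},
  e = \sum_s basis_wedge s *~ c s.

Lemma wedge_span0 : wedge_span 0.
Proof. by exists 0; rewrite big1 // => s _; rewrite ffunE mulr0z. Qed.

Lemma wedge_spanB e e' : wedge_span e -> wedge_span e' -> wedge_span (e - e').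
Proof.
move=> [c ->] [d ->]; exists (c - d); rewrite -sumrB; apply: eq_bigr => s _.
by rewrite !ffunE mulrzBr.
Qed.

Lemma wedge_spanN e : wedge_span e -> wedge_span (- e).
Proof. by rewrite -sub0r; apply: wedge_spanB; apply: wedge_span0. Qed.

Lemma wedge_spanD e e' : wedge_span e -> wedge_span e' -> wedge_span (e + e').
Proof. by move=> Se /wedge_spanN /(wedge_spanB Se); rewrite opprK. Qed.

Lemma wedge_spanMz e k : wedge_span e -> wedge_span (e *~ k).
Proof.
move=> [c ->]; exists [ffun s => c s * k]; rewrite mulrz_suml; apply: eq_bigr => s _.
by rewrite ffunE mulrzA.
Qed.

(** A repeated index gives zero; otherwise sorting the indices costs only a sign, whose value is
    irrelevant to spanning. *)
Lemma wedge_span_basis f : wedge_span (wedge (basis_fun f)).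
Proof.
have [f_inj|] := boolP (injectiveb f); last first.
  case/injectivePn => i [j ij fij].
  by rewrite (@wedge_alt _ _ _ i j) ?ffunE ?fij //; apply: wedge_span0.
have /injectiveP {}f_inj := f_inj.
pose s := sort_tuple (relpre val leq) [tuple f i | i < m].
have f_uniq : uniq [tuple f i | i < m].
  by apply/tuple_uniqP => i j; rewrite !tnth_mktuple => /f_inj.
have s_sorted : sorted ltn [seq val i | i <- s].
  rewrite ltn_sorted_uniq_leq (map_inj_uniq val_inj) sort_uniq f_uniq /= -sort_map.
  by rewrite sort_sorted //; apply: leq_total.
have /tuple_permP[p pE] : perm_eq [tuple f i | i < m] s by rewrite perm_sym perm_sort.
have fE : basis_fun f = [ffun i => basis_fun (tnth s) (p i)].
  apply/ffunP => i; rewrite !ffunE; congr delta_mx.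
  have := congr1 (fun t => nth (f i) t i) pE.
  by rewrite -!tnth_nth !tnth_mktuple.
have span_s : wedge_span (basis_wedge (exist _ s s_sorted)).
  exists [ffun r => (r == exist _ s s_sorted)%:R].
  rewrite (bigD1 (exist _ s s_sorted)) //= ffunE eqxx mulr1z big1 ?addr0 // => r rs.
  by rewrite ffunE (negbTE rs) mulr0z.
have [b bE] := wedge_perm (basis_fun (tnth s)) p.
by rewrite fE bE; case: b {bE}; [|apply: wedge_spanN]; apply: span_s.
Qed.

Lemma wedge_span_wedge t : wedge_span (wedge t).
Proof.
(* The arguments are expanded one slot at a time: those in slots k and beyond are already basis
   vectors, so k = m is the general case. *)
suff span k : forall t : {ffun 'I_m -> V},
    (forall i : 'I_m, (k <= i)%N -> exists f, t i = delta_mx ord0 f) ->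
  wedge_span (wedge t).
  by apply: (span m) => i; rewrite leqNgt ltn_ord.
elim: k => [|k IHk] {}t t_basis.
  have [f fE] := fin_all_exists (fun i => t_basis i isT).
  have -> : t = basis_fun f by apply/ffunP => i; rewrite ffunE.
  exact: wedge_span_basis.
have [km|mk] := ltnP k m; last first.
  by apply: IHk => i ki; move: (leq_trans mk ki); rewrite leqNgt ltn_ord.
pose i0 := Ordinal km; pose f := additive_of (wedge_upd_is_additive t i0).
rewrite -(upd_id t i0) -[wedge _]/(f (t i0)) (row_sum_delta (t i0)) raddf_sum.
elim/big_ind: _ => [||j _]; [exact: wedge_span0 | exact: wedge_spanD |].
rewrite -[t i0 _ _]intz scaler_int raddfMz; apply: wedge_spanMz; apply: IHk => i ki.
rewrite ffunE; case: eqP => [_|/eqP i_neq]; first by exists j.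
by apply: t_basis; rewrite ltn_neqAle ki andbT eq_sym.
Qed.

Lemma wedge_spanT e : wedge_span e.
Proof.
apply: ext_generated e; [exact: wedge_span0 | exact: wedge_spanB |].
exact: wedge_span_wedge.
Qed.

Theorem extpow_iso : zmod_iso E 'rV[int]_'C(n, m).
Proof.
rewrite -card_wedge_index.
pose F (t : {ffun 'I_m -> V}) : 'rV[int]_#|wedge_index| :=
  \row_j minor (tnth (val (enum_val j))) t.
have [||h hE] := @ext_lift m V _ F.
- by move=> t i x y; apply/rowP => j; rewrite !mxE minor_updD.
- by move=> t i j ij tij; apply/rowP => l; rewrite !mxE (minor_alt _ ij tij).
have h_span (c : {ffun wedge_index -> int}) :
    h (\sum_s basis_wedge s *~ c s) = \row_j c (enum_val j).
  apply/rowP => j; rewrite raddf_sum summxE mxE (bigD1 (enum_val j)) //= big1 ?addr0.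
    by rewrite raddfMz /= hE -scaler_int !mxE minor_basis eqxx mulr1 intz.
  move=> s sj; rewrite raddfMz /= hE -scaler_int !mxE minor_basis eq_sym (negbTE sj).
  by rewrite mulr0.
exists h; apply: inj_surj_bijective => [e e' hee'|y].
  apply/eqP; rewrite -subr_eq0; apply/eqP; have [c cE] := wedge_spanT (e - e').
  have : h (e - e') = 0 by rewrite raddfB /= hee' subrr.
  rewrite cE h_span => /rowP c0; apply: big1 => s _.
  by have := c0 (enum_rank s); rewrite !mxE enum_rankK => ->; rewrite mulr0z.
exists (\sum_s basis_wedge s *~ y ord0 (enum_rank s)).
rewrite -[RHS](_ : \row_j y ord0 (enum_rank (enum_val j)) = y); last first.
  by apply/rowP => j; rewrite mxE enum_valK.
have := h_span [ffun s => y ord0 (enum_rank s)].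
under eq_bigr do rewrite ffunE.
by move=> ->; apply/rowP => j; rewrite !mxE ffunE.
Qed.
End ExteriorBasis.

(** * Homology of the surface module *)

Section Omega.
Variable g : nat.
Hypothesis g_gt0 : (0 < g)%N.

(** The coefficient of the first pair x_1 /\ x_2, read off by a 2 by 2 minor, is 1. *)
Lemma omega_unimodular :
  exists f : {additive extpow 2 'rV[int]_(2 * g) -> int}, f (omega g) = 1.
Proof.
pose i0 := Ordinal g_gt0; pose s (k : 'I_2) := pair_ord i0 (k == 1 :> nat).
have [||f fE] := @ext_lift 2 'rV[int]_(2 * g) _ (minor s).
- exact: minor_updD.
- exact: minor_alt.
have pair_ordE i (b c : bool) : (pair_ord i b == pair_ord i0 c) = (i == i0) && (b == c).
  rewrite -!val_eqE /= double0 add0n; case: b c => [] [].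
  all: rewrite ?addn1 ?addn0 ?andbT ?andbF ?double_eq0 //.
    by rewrite eqSS double_eq0.
  by case: (nat_of_ord i).
have minorE (i : 'I_g) (k l : 'I_2) : basis_pair i k ord0 (s l) = ((i == i0) && (k == l))%:R.
  rewrite ffunE mxE eqxx /= eq_sym pair_ordE; congr (nat_of_bool (_ && _))%:R.
  by case: k => [[|[|k]] //= k2]; case: l => [[|[|l]] //= l2].
exists f; rewrite /omega raddf_sum (bigD1 i0) //= big1 ?addr0 => [|i ii0].
  rewrite fE -[RHS](@det1 _ 2); congr (\det _); apply/matrixP => k l.
  by rewrite !mxE minorE eqxx.
rewrite fE -[RHS](@det0 _ 1); congr (\det _); apply/matrixP => k l.
by rewrite !mxE minorE (negbTE ii0).
Qed.
End Omega.

Section SurfaceHomology.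
Variable g : nat.
Hypothesis g_gt0 : (0 < g)%N.
Local Notation aug := (@aug (H1_lattice g)).
Local Notation aug_mx := (map_mx aug).

Definition omega_row : 'rV[int]_(kdim 2 g.*2) := aug_mx (relator_chain (@lattice_gelt g) g).

Lemma aug_koszul m : aug_mx (koszul (@tvar g) m g.*2) = 0.
Proof. by apply: koszul_const_mx => k; rewrite /= augT. Qed.

Lemma omega_row_unimodular : exists f : {additive 'rV[int]_(kdim 2 g.*2) -> int},
  f omega_row = 1.
Proof.
rewrite /omega_row; case: g g_gt0 => // g' _.
(* The coordinate at the last pair of generators; there [relator_chain] has minus a group element,
   which augments to -1, hence the sign in [lastB]. *)
pose last (x : 'rV[int]_(kdim 2 g'.+1.*2)) : int :=
  (@rsubmx _ _ (kdim 1 g'.*2) (kdim 0 g'.*2)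
    (@rsubmx _ _ (kdim 2 g'.*2.+1) (kdim 1 g'.*2.+1) x)) ord0 ord0.
have lastB : zmod_morphism (fun x => - last x).
  by move=> x y; rewrite /last !linearB !mxE opprB addrC opprK.
exists (additive_of lastB) => /=.
rewrite /last /koszul_pair -!map_rsubmx !row_mxKr !mxE eqxx mulr1n rmorphN opprK.
by rewrite [LHS]augT.
Qed.

Lemma aug_res_mx k : (0 < k)%N -> aug_mx (res_mx g k) = 0.
Proof.
case: k => [//|[|k]] _; last exact: aug_koszul.
rewrite -[res_mx g 1]/(@row_mx _ _ (kdim 3 g.*2) 1 (koszul (@tvar g) 3 g.*2) 0).
by rewrite map_row_mx aug_koszul map_mx0 row_mx0.
Qed.

Lemma aug_res_mx0 (x : 'rV[int]_(res_rank g 1)) :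
  x *m aug_mx (res_mx g 0) = omega_row *~ (@rsubmx _ _ (kdim 3 g.*2) 1 x) ord0 ord0.
Proof.
rewrite -[res_mx g 0]/(@col_mx _ (kdim 3 g.*2) 1 _ (koszul (@tvar g) 2 g.*2) _).
rewrite map_col_mx aug_koszul -[x in LHS](@hsubmxK _ _ (kdim 3 g.*2) 1) mul_row_col.
rewrite mulmx0 add0r [X in X *m _]mx11_scalar mul_scalar_mx -scaler_int intz.
by [].
Qed.

Let surface_homology := resolution_homology (@lattice_mulgC g) (res_exact g_gt0)
  (@augment_surj g) (@augment_kernel g).

Lemma homology0_iso :
  zmod_iso (homology (surface_module g) 0) 'rV[int]_((kdim 2 g.*2).-1).
Proof.
have [f fw] := omega_row_unimodular.
have [q [q_surj q_ker]] := unimodular_row_quotient fw.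
apply: (@surface_homology 0 _ q) => [y|x _].
  by have [x <-] := q_surj y; exists x.
apply: iff_trans (q_ker x) _; split=> [[c ->]|[w ->]].
  exists (@row_mx _ _ (kdim 3 g.*2) 1 0 c%:M).
  by rewrite aug_res_mx0 row_mxKr mxE eqxx mulr1n.
by exists ((@rsubmx _ _ (kdim 3 g.*2) 1 w) ord0 ord0); rewrite aug_res_mx0.
Qed.

Lemma homology1_iso :
  zmod_iso (homology (surface_module g) 1) 'rV[int]_(kdim 3 g.*2).
Proof.
pose q (x : 'rV[int]_(res_rank g 1)) : 'rV[int]_(kdim 3 g.*2) :=
  @lsubmx _ _ (kdim 3 g.*2) 1 x.
have qB : zmod_morphism q by move=> x y; rewrite /q linearB.
have [f fw] := omega_row_unimodular.
apply: (@surface_homology 1 _ (additive_of qB)) => [y|x xD].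
  exists (@row_mx _ _ (kdim 3 g.*2) 1 y 0); last exact: row_mxKl.
  by rewrite /= aug_res_mx0 row_mxKr mxE mulr0z.
split=> [qx0|[w ->]]; last by rewrite aug_res_mx // mulmx0 raddf0.
have {}qx0 : q x = 0 := qx0.
exists 0; rewrite mul0mx -[LHS](@hsubmxK _ _ (kdim 3 g.*2) 1) -[lsubmx _]/(q x) qx0.
suff -> : @rsubmx _ _ (kdim 3 g.*2) 1 x = 0 by rewrite row_mx0.
(* The functional with value 1 on [omega_row] reads off the extra coordinate, so it vanishes on
   cycles and leaves only the coinvariants of K_3. *)
move: xD; rewrite /= aug_res_mx0 => /(congr1 f); rewrite raddfMz fw raddf0.
by rewrite [rsubmx _ in X in _ -> X]mx11_scalar intz => ->; rewrite raddf0.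
Qed.

Lemma homologySS_iso k :
  zmod_iso (homology (surface_module g) k.+2) 'rV[int]_(kdim k.+4 g.*2).
Proof.
apply: (@surface_homology k.+2 _ idfun) => [y|x _].
  exists y => //; change (y *m aug_mx (res_mx g k.+1) = 0).
  by rewrite aug_res_mx // mulmx0.
split=> [x0|[w ->]]; last by rewrite aug_res_mx // mulmx0.
by exists 0; rewrite mul0mx; apply: x0.
Qed.
End SurfaceHomology.

Theorem theorem4 (g : nat) (g_ge1 : (1 <= g)%N) :
  [/\ zmod_iso (homology (surface_module g) 0)
               (@zquot (extpow 2 'rV[int]_(2 * g)) (fun w => w = omega g)),
      forall k : nat, (1 <= k)%N ->
        zmod_iso (homology (surface_module g) k)
                 (extpow (k + 2) 'rV[int]_(2 * g))
    & (2 <= g)%N -> ~ free_module (surface_module g)].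
Proof.
split=> [|[|[|k]] // _|g_ge2 /free_module_homology H1_0].
(* Both sides are free abelian of rank binomial(2g, 2) - 1. *)
- apply: zmod_iso_trans (homology0_iso g_ge1) _; apply: zmod_iso_sym.
  have [f fw] := omega_unimodular g_ge1.
  have [q [q_surj q_ker]] := unimodular_quotient (extpow_iso 2 (2 * g)) fw.
  rewrite kdimE -mul2n; apply: (zquot_iso q_surj) => x.
  by rewrite q_ker; apply: iff_sym; apply: zspan1.
- apply: zmod_iso_trans (homology1_iso g_ge1) _; apply: zmod_iso_sym.
  by rewrite kdimE -mul2n; apply: extpow_iso.
- apply: zmod_iso_trans (homologySS_iso g_ge1 k) _; apply: zmod_iso_sym.
  by rewrite kdimE -mul2n addn2; apply: extpow_iso.
(* The first homology would vanish, whereas it is free abelian of rank binomial(2g, 3) > 0; the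
   all-ones vector is a nonzero element. *)
have [h [h' _ h'K]] := homology1_iso g_ge1.
have dim_gt0 : (0 < kdim 3 g.*2)%N.
  by rewrite kdimE bin_gt0 (leq_trans (_ : 3 <= 2.*2)%N) // leq_double.
have /rowP/(_ (Ordinal dim_gt0)) : const_mx 1 = 0 :> 'rV[int]_(kdim 3 g.*2).
  by rewrite -[LHS]h'K [h' _]H1_0 raddf0.
by rewrite !mxE.
Qed.
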